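(* Let $\mathcal X$ be an infinite dimensional Banach space, let $A$ generate a $C^0$ semigroup of bounded linear operators on $\mathcal X$, and let $B$ be a bounded linear operator on $\mathcal X$. Then for every $T>0$ there exists a unique continuous extension to $L^1([0,T],\mathbf R)$ of the input-output mapping $u\mapsto\Upsilon^u_T\in L(\mathcal X,\mathcal X)$ of the system $\frac{d}{dt}x(t)=(A+u(t)B)x(t)$ (initially defined for piecewise constant $u$), and, for every $\psi_0\in\mathcal X$, the set $$\bigcup_{T\ge 0}\ \bigcup_{u\in L^1([0,T],\mathbf R)}\{\Upsilon^u_t\psi_0\mid t\in[0,T]\}$$ is contained in a countable union of compact subsets of $\mathcal X$ and, in particular, has dense complement.
   Context: $L(\mathcal X,\mathcal X)$ is the Banach space of bounded linear operators on $\mathcal X$. Since $B$ is bounded, $A+uB$ generates a $C^0$ semigroup for every $u\in\mathbf R$. For a right-continuous piecewise constant function $u=\sum_{j=1}^p u_j\mathbb I_{[\tau_j,\tau_{j+1})}$ on $[0,T)$ with real values $u_j$ and $0=\tau_1<\tau_2<\dots<\tau_{p+1}=T$, the propagator is $$\Upsilon^u_{t}=e^{(t-\tau_j)(A+u_jB)}\circ e^{(\tau_j-\tau_{j-1})(A+u_{j-1}B)}\circ\cdots\circ e^{(\tau_2-\tau_1)(A+u_1B)}\quad\text{for } t\in[\tau_j,\tau_{j+1}].$$ For $u\in L^1([0,T],\mathbf R)$ and $t\in[0,T]$, $\Upsilon^u_t$ denotes the value of the continuous extension to $L^1([0,t],\mathbf R)$ at the restriction of $u$ to $[0,t]$. 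*)

(* Defs.v *)
From HB Require Import structures.
From mathcomp Require Import all_boot all_order all_algebra.
From mathcomp Require Import complex.
From mathcomp Require Import all_classical all_reals all_analysis.

Set Implicit Arguments.
Unset Strict Implicit.
Unset Printing Implicit Defensive.

Import Order.TTheory GRing.Theory Num.Theory.
Import numFieldNormedType.Exports.

Local Open Scope classical_set_scope.
Local Open Scope ring_scope.

(* Banach spaces are taken over K, which is R or R[i]; time and controls are
   always in R, and iota is the inclusion of R in K. *)
Variant real_or_complex (R : realType) :
    forall K : numFieldType, (R -> K) -> Prop :=
  | RealScalars : @real_or_complex R R idfun
  | ComplexScalars : @real_or_complex R R[i] (real_complex R).

Section BilinearSystem.
Context (R : realType) (K : numFieldType) (iota : R -> K).
Context (X : completeNormedModType K).

Definition infinite_dimensional : Prop :=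
  ~ exists (n : nat) (e : 'I_n -> X),
      forall x : X, exists c : 'I_n -> K, x = \sum_(i < n) c i *: e i.

Definition bounded_operator (F : X -> X) : Prop :=
  linear F /\ exists M : R, forall x, `|F x| <= iota M * `|x|.

Definition opnorm (F : X -> X) : R :=
  inf [set M : R | 0 <= M /\ forall x, `|F x| <= iota M * `|x|].

(* Only the values S t with 0 <= t are meaningful. *)
Definition C0_semigroup (S : R -> X -> X) : Prop :=
  [/\ forall t : R, 0 <= t -> bounded_operator (S t),
      S 0 = id,
      forall s t : R, 0 <= s -> 0 <= t -> S (s + t) = S s \o S t
    & forall x, S t x @[t --> 0^'+] --> x].

(* An unbounded operator is given by its domain D and a function A of which
   only the restriction to D matters; the equivalence says that the graph
   of A on D is exactly the graph of the generator of S. *)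
Definition generates (D : set X) (A : X -> X) (S : R -> X -> X) : Prop :=
  C0_semigroup S /\
  forall x y, (D x /\ A x = y) <->
    iota t^-1 *: (S t x - x) @[t --> 0^'+] --> y.

(* The semigroup t |-> e^(t A), for t >= 0, whenever A generates one. *)
Definition semigroup (D : set X) (A : X -> X) : R -> X -> X :=
  xget ((fun=> id) : R -> X -> X) [set S | generates D A S].

Definition subdivision (T : R) (p : nat) (tau : nat -> R) : Prop :=
  [/\ tau 0%N = 0, tau p = T & forall j, (j < p)%N -> tau j < tau j.+1].

Definition step_control (p : nat) (tau v : nat -> R) : R -> R :=
  fun t => \sum_(j < p) v j * \1_(`[tau j, tau j.+1[%classic) t.

(* The propagator of step_control p tau v at the final time tau p. *)
Fixpoint step_propagator (D : set X) (A B : X -> X) (p : nat)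
    (tau v : nat -> R) : X -> X :=
  if p is j.+1 then
    semigroup D (fun x => A x + iota (v j) *: B x) (tau j.+1 - tau j)
      \o step_propagator D A B j tau v
  else id.

(* Elements of L^1([0, T], R) are represented by functions on R integrable on
   [0, T], without passing to the quotient by a.e. equality: a map that is
   continuous for the L^1 seminorm below identifies functions that are a.e.
   equal on [0, T]. In particular, restriction to [0, t] leaves the
   representative unchanged. *)
Definition L1 (T : R) : set (R -> R) :=
  [set u : R -> R | (@lebesgue_measure R).-integrable `[0, T] (EFin \o u)].

Definition L1_dist (T : R) (u v : R -> R) : \bar R :=
  (\int[@lebesgue_measure R]_(s in `[0%R, T]) `|u s - v s|%:E)%E.

(* F : L^1([0, T], R) -> L(X, X) is continuous in operator norm and extends the
   input-output mapping of piecewise constant controls. For T = 0 the only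
   subdivision is the one with no interval, whose propagator is id. *)
Definition continuous_extension (D : set X) (A B : X -> X) (T : R)
    (F : (R -> R) -> X -> X) : Prop :=
  [/\ forall u, L1 T u -> bounded_operator (F u),
      forall u, L1 T u -> forall eps : R, 0 < eps ->
        exists2 delta : R, 0 < delta &
          forall v, L1 T v -> (L1_dist T u v < delta%:E)%E ->
            opnorm (fun x => F u x - F v x) < eps
    & forall p tau v, subdivision T p tau ->
        F (step_control p tau v) = step_propagator D A B p tau v].

Definition propagator (D : set X) (A B : X -> X) (t : R) :
    (R -> R) -> X -> X :=
  xget ((fun=> id) : (R -> R) -> X -> X) [set F | continuous_extension D A B t F].

Definition attainable_set (D : set X) (A B : X -> X) (psi0 : X) : set X :=
  \bigcup_(T in [set T : R | 0 <= T]) \bigcup_(u in L1 T)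
    [set propagator D A B t u psi0 | t in `[0, T]].

End BilinearSystem.

(* Main.v *)
(* Replace a control u by impulses: on each interval of a subdivision, apply
   1 + c B with c the integral of u there, then let e^(tA) act. In a norm for
   which |e^(tA)| <= e^(wt) these products are bounded in terms of the total
   time and the total mass of the impulses alone. For bounded time and mass, the
   states they reach from psi0 form a totally bounded set Z: by Duhamel's formula
   they are sums of e^(tA) psi0 and of a combination of bounded weight of points
   of e^(sA) B Z, so that a suitably weighted distance of Z to totally bounded
   sets is at most half of itself.

   On the closure of Z all strong convergences are uniform. Hence grouping the
   impulses of short intervals costs o(1), the products converge as the mesh
   tends to 0, and their limit is a cocycle in time, Lipschitz in u for the L^1
   norm on bounded sets and equal for constant u to e^(t(A+uB)). This is the
   extension; the states attained by time n with |u|_1 <= n lie in the compact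
   closure of Z, and Baire's and Riesz's theorems give the dense complement. *)
Require Import Defs.
From HB Require Import structures.
From mathcomp Require Import all_boot all_order all_algebra.
From mathcomp Require Import complex ring lra.
From mathcomp Require Import all_classical all_reals all_analysis.

Set Implicit Arguments.
Unset Strict Implicit.
Unset Printing Implicit Defensive.

Import Order.TTheory GRing.Theory Num.Theory.
Import numFieldNormedType.Exports.

Local Open Scope classical_set_scope.
Local Open Scope ring_scope.

(** * Totally bounded sets *)

(** The obstacle is that [S] is only strongly continuous: moving an impulse by a short time changes
    the state by an amount that has no rate and is not uniform in the state. Two facts still make
    the sum over the blocks of a subdivision small. The error of one block is proportional to the
    mass of that block, so the errors add up to [e] times the total mass; and [e] is uniform because
    all intermediate states lie in one totally bounded set. This set has to be controlled before any
    limit exists, for lists of impulses of any length, which is why compactness is proved for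
    discrete trajectories.

    [semigroup] and [propagator] are choices by [xget], so they have to be identified by uniqueness.
    For semigroups it rests on the density of the domain of the generator, obtained by running the
    same impulse scheme on [Y * R^o]; for extensions, on the density of step controls. All estimates
    are over R; linearity over K is recovered because scalars of K commute with [S] and [B]. *)

Definition totally_bounded (K : numFieldType) (V : normedModType K)
    (A : set V) := forall e : K, 0 < e ->
  exists s : seq V, forall x, A x -> exists2 y, y \in s & `|x - y| <= e.

(** Pigeonhole for ultrafilters. It turns a finite net into one small ball that belongs to the
    filter, which makes the filter Cauchy. *)
Lemma ultra_has (T : Type) (V : eqType) (F : set_system T) (B : V -> set T)
    (s : seq V) :
  UltraFilter F -> F [set x | exists2 y, y \in s & B y x] ->
  exists y, F (B y).
Proof.
move=> uF; elim: s => [|e s IH].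
  by move=> /filter_ex[x [y]].
have [eF|eF] := in_ultra_setVsetC (B e) uF; first by exists e.
move=> sF; apply: IH; apply: filterS (filterI eF sF) => x [nex [y]].
by rewrite inE => /orP[/eqP->//|ys yx]; exists y.
Qed.

Lemma totally_bounded_compact (K : numFieldType) (V : completeNormedModType K)
    (A : set V) : totally_bounded A -> compact (closure A).
Proof.
move=> tA; rewrite compact_ultra => F uF FA /=.
have cF : cauchy F.
  apply: cauchy_exP => e e0; have e20 : 0 < e / 2 by rewrite divr_gt0.
  have [s sP] := tA _ e20.
  apply: (@ultra_has _ _ F (fun y => ball y e) s) => //.
  apply: filterS FA => x clx.
  have [z [Az xz]] := clx _ (nbhsx_ballx x _ e20).
  have [y ys zy] := sP _ Az; exists y => //.
  rewrite -ball_normE/= distrC; apply: le_lt_trans (ler_distD z _ _) _.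
  rewrite [e]splitr addrC; apply: ler_ltD => //.
  by move: xz; rewrite -ball_normE /= distrC.
have pF : ProperFilter F by exact: ultra_proper.
have Fp : cvg F by apply: cauchy_cvg.
exists (lim F); split; last exact: Fp.
have cl : closed (closure A) by exact: closed_closure.
exact: (@closed_cvg _ _ F pF id _ cl FA (lim F) Fp).
Qed.

Section TotallyBounded.
Context (R : realType) (Y : completeNormedModType R).
Implicit Types (A C : set Y) (x y z : Y).

(** The approximating set may be infinite, so nets can be built in stages: a hull through a
    zonotope, an orbit through the orbit of a net, the outcomes through Duhamel sums. *)
Lemma totally_bounded_near A :
  (forall e : R, 0 < e -> exists2 C, totally_bounded C &
     forall x, A x -> exists2 y, C y & `|x - y| <= e) -> totally_bounded A.
Proof.
move=> h e e0; have e20 : 0 < e / 2 by rewrite divr_gt0.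
have [C tC sAC] := h _ e20; have [s sP] := tC _ e20.
exists s => x /sAC[y /sP[z zs yz] xy]; exists z => //.
by have := ler_distD y x z; lra.
Qed.

Lemma totally_bounded1 x : totally_bounded [set x].
Proof.
move=> e e0; exists [:: x] => _ ->; exists x; rewrite ?inE//.
by rewrite subrr normr0 ltW.
Qed.

Lemma totally_bounded_bounded A : totally_bounded A ->
  exists2 M : R, 0 <= M & forall x, A x -> `|x| <= M.
Proof.
move=> /(_ 1 ltr01)[s sP]; exists (1 + \sum_(y <- s) `|y|).
  by rewrite addr_ge0// sumr_ge0.
move=> x /sP[y ys xy].
have : `|y| <= \sum_(y <- s) `|y|.
  elim: s ys {sP} => // a s IH; rewrite inE big_cons => /orP[/eqP->|/IH].
    by rewrite lerDl sumr_ge0.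
  by move=> /le_trans; apply; rewrite lerDr.
by have := ler_distD 0 x y; have := lerB_dist x y; lra.
Qed.

Lemma totally_bounded_lipschitz (f : Y -> Y) A (k : R) :
  (forall x y, `|f x - f y| <= k * `|x - y|) ->
  totally_bounded A -> totally_bounded (f @` A).
Proof.
move=> fk tA e e0.
have k0 : 0 < `|k| + 1 by rewrite ltr_wpDl.
have [s sP] := tA (e / (`|k| + 1)) (divr_gt0 e0 k0).
exists [seq f y | y <- s] => _ [x Ax <-]; have [y ys xy] := sP _ Ax.
exists (f y); first by apply/mapP; exists y.
apply: le_trans (fk _ _) _.
apply: (@le_trans _ _ ((`|k| + 1) * `|x - y|)).
  by rewrite ler_wpM2r//; have := ler_norm k; lra.
by rewrite mulrC -ler_pdivlMr.
Qed.

Lemma totally_boundedD A C : totally_bounded A -> totally_bounded C ->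
  totally_bounded [set x + y | x in A & y in C].
Proof.
move=> tA tC e e0; have e20 : 0 < e / 2 by rewrite divr_gt0.
have [s sP] := tA _ e20; have [r rP] := tC _ e20.
exists [seq x + y | x <- s, y <- r] => _ [x Ax [y yC <-]].
have [x' x's xx'] := sP _ Ax; have [y' y'r yy'] := rP _ yC.
exists (x' + y'); first by apply/allpairsP; exists (x', y').
have -> : x + y - (x' + y') = (x - x') + (y - y') by rewrite opprD addrACA.
by have := ler_normD (x - x') (y - y'); lra.
Qed.

Lemma totally_bounded_segment (m : R) x :
  totally_bounded [set a *: x | a in [set a | `|a| <= m]].
Proof.
move=> e e0; have x0 : 0 < `|x| + 1 by rewrite ltr_wpDl.
pose d := e / (`|x| + 1); have d0 : 0 < d by rewrite divr_gt0.
(* A step of length [d] moves [a *: x] by at most [e], and [n] grid points starting at [- |m|] reach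
   [|m|]. *)
pose n := (Num.truncn (2 * `|m| / d)).+1.
exists [seq (k%:R * d - `|m|) *: x | k <- iota 0 n] => _ [a am <-].
have am' : `|a| <= `|m| by apply: le_trans am (ler_norm _).
have am0 : 0 <= a + `|m| by have := ler_norm (- a); rewrite normrN; lra.
pose k := Num.truncn ((a + `|m|) / d).
have q0 : 0 <= (a + `|m|) / d by rewrite divr_ge0// ltW.
have /andP[k1 k2] := truncn_itv q0.
exists ((k%:R * d - `|m|) *: x).
  apply/mapP; exists k => //; rewrite mem_iota/= add0n ltnS.
  apply: le_truncn; rewrite ler_pM2r ?invr_gt0//.
  by have := ler_norm a; lra.
rewrite -scalerBl normrZ.
move: k1 k2; rewrite -/k ler_pdivlMr// ltr_pdivrMr// -natr1 => k1 k2.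
have ad : `|a - (k%:R * d - `|m|)| <= d.
  by rewrite ger0_norm; lra.
apply: (@le_trans _ _ (d * (`|x| + 1))).
  by apply: ler_pM => //; lra.
by rewrite /d divfK// gt_eqF.
Qed.

(** Discrete counterpart of integrating points of [A] against a signed measure: [m] is the sum of
    the absolute values of the coefficients. Terms are appended on the right, in the order in which
    impulses act. *)
Inductive abs_hull A : R -> Y -> Prop :=
| abs_hull0 : abs_hull A 0 0
| abs_hullD m x c y : abs_hull A m x -> A y -> abs_hull A (m + `|c|) (x + c *: y).

Lemma sub_abs_hull A C m x : A `<=` C -> abs_hull A m x -> abs_hull C m x.
Proof.
by move=> sAC; elim => [|{}m {}x c y _ IH Ay]; constructor => //; exact: sAC.
Qed.

(** Every generator gets the full allowance [m], so this is larger than the set of combinations of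
    total weight [m]; as a finite Minkowski sum of segments it is still totally bounded. *)
Fixpoint zonotope (m : R) (s : seq Y) : set Y :=
  if s is e :: s' then
    [set x + y | x in [set a *: e | a in [set a | `|a| <= m]] & y in zonotope m s']
  else [set 0].

Lemma totally_bounded_zonotope m s : totally_bounded (zonotope m s).
Proof.
elim: s => [|e s IH] /=; first exact: totally_bounded1.
by apply: totally_boundedD => //; exact: totally_bounded_segment.
Qed.

Lemma zonotope0 m s : 0 <= m -> zonotope m s 0.
Proof.
move=> m0; elim: s => //= e s IH; exists 0; last by exists 0; rewrite ?addr0.
by exists 0; rewrite ?scale0r//= normr0.
Qed.

Lemma zonotopeS m m' s : m <= m' -> zonotope m s `<=` zonotope m' s.
Proof.
move=> mm'; elim: s => //= e s IH _ [_ [a am <-] [y /IH ym <-]].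
exists (a *: e); last by exists y.
by exists a => //=; apply: le_trans mm'.
Qed.

Lemma zonotopeD m s x c y : zonotope m s x -> y \in s ->
  zonotope (m + `|c|) s (x + c *: y).
Proof.
elim: s x => //= e s IH _ [_ [a am <-] [z zm <-]].
have cm : m <= m + `|c| by rewrite lerDl.
have [->|ye] := eqVneq y e.
  move=> _; exists ((a + c) *: e); last first.
    by exists z; [exact: zonotopeS zm|rewrite scalerDl addrAC].
  by exists (a + c) => //=; apply: le_trans (ler_normD _ _) _; rewrite lerD2r.
rewrite inE (negbTE ye)/= => ys; exists (a *: e).
  by exists a => //=; exact: le_trans cm.
by exists (z + c *: y); [exact: IH|rewrite addrA].
Qed.

(** Replacing every point of [A] by a nearby net point costs at most [m] times the fineness of the
    net, whatever the number of terms, and leaves a combination of finitely many vectors. *)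
Lemma totally_bounded_hull A (M : R) : totally_bounded A ->
  totally_bounded [set x | exists2 m, m <= M & abs_hull A m x].
Proof.
move=> tA; apply: totally_bounded_near => e e0.
have M0 : 0 < `|M| + 1 by rewrite ltr_wpDl.
have [s sP] := tA (e / (`|M| + 1)) (divr_gt0 e0 M0).
exists (zonotope M s); first exact: totally_bounded_zonotope.
suff H m x : abs_hull A m x -> 0 <= m /\
    exists2 y, zonotope m s y & `|x - y| <= m * (e / (`|M| + 1)).
  move=> x [m mM /H[m0 [y ym xy]]]; exists y; first exact: zonotopeS ym.
  apply: le_trans xy _; rewrite mulrA ler_pdivrMr// mulrC.
  by rewrite ler_pM2l//; have := ler_norm M; lra.
elim => [|{}m {}x c y _ [m0 [z zm xz]] /sP[y' y's yy']].
  by split => //; exists 0; [exact: zonotope0|rewrite subrr normr0 mul0r].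
split; first by rewrite addr_ge0.
exists (z + c *: y'); first exact: zonotopeD.
have -> : x + c *: y - (z + c *: y') = (x - z) + c *: (y - y').
  by rewrite scalerBr opprD addrACA.
apply: le_trans (ler_normD _ _) _; rewrite mulrDl lerD// normrZ.
by rewrite ler_wpM2l.
Qed.

End TotallyBounded.

(** * Kicked trajectories *)

Record quasi_contractive (R : realType) (Y : completeNormedModType R)
    (S : R -> Y -> Y) (w : R) : Prop := QuasiContractive {
  qc_ge0 : 0 <= w;
  qc_linear : forall t, 0 <= t -> linear (S t);
  qc_id : S 0 = id;
  qc_add : forall s t, 0 <= s -> 0 <= t -> S (s + t) = S s \o S t;
  qc_bound : forall t x, 0 <= t -> `|S t x| <= expR (w * t) * `|x|;
  qc_continuous : forall x (e : R), 0 < e ->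
    exists2 d : R, 0 < d & forall t, 0 <= t <= d -> `|S t x - x| <= e }.

Lemma qc_addE (R : realType) (Y : completeNormedModType R) (S : R -> Y -> Y)
    (w s t : R) (x : Y) : quasi_contractive S w -> 0 <= s -> 0 <= t ->
  S (s + t) x = S s (S t x).
Proof. by move=> qS s0 t0; rewrite (qc_add qS). Qed.

Record lin_bounded (R : realType) (Y : completeNormedModType R)
    (B : Y -> Y) (b : R) : Prop := LinBounded {
  lb_ge0 : 0 <= b;
  lb_linear : linear B;
  lb_bound : forall x, `|B x| <= b * `|x| }.

Section LinearFacts.
Context (R : nzRingType) (Y Z : lmodType R) (f : Y -> Z) (lf : linear f).

Lemma lin0 : f 0 = 0.
Proof. by have := lf (-1) 0 0; rewrite scaler0 addr0 scaleN1r addNr. Qed.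

Lemma linZ a x : f (a *: x) = a *: f x.
Proof. by have := lf a x 0; rewrite !addr0 lin0 addr0. Qed.

Lemma linD x y : f (x + y) = f x + f y.
Proof. by have := lf 1 x y; rewrite !scale1r. Qed.

Lemma linN x : f (- x) = - f x.
Proof. by rewrite -scaleN1r linZ scaleN1r. Qed.

Lemma linB x y : f (x - y) = f x - f y.
Proof. by rewrite linD linN. Qed.

End LinearFacts.

Section Kicks.
Context (R : realType) (Y : completeNormedModType R).
Context (S : R -> Y -> Y) (w : R) (qS : quasi_contractive S w).
Context (B : Y -> Y) (b : R) (lB : lin_bounded B b).
Implicit Types (l : seq (R * R)) (x y z : Y) (A C : set Y).

(* An impulse of amount p.2 followed by the free evolution during p.1. *)
Definition kick (z : Y) (p : R * R) : Y := S p.1 (z + p.2 *: B z).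
Definition kicks l z : Y := foldl kick z l.
Definition dur l : R := \sum_(p <- l) p.1.
Definition mass l : R := \sum_(p <- l) `|p.2|.
Definition forward l : bool := all (fun p => 0 <= p.1) l.

Let w0 : 0 <= w := qc_ge0 qS.
Let b0 : 0 <= b := lb_ge0 lB.

Lemma dur_ge0 l : forward l -> 0 <= dur l.
Proof.
by move=> /allP fl; rewrite /dur big_seq; apply: sumr_ge0 => p /fl.
Qed.

Lemma mass_ge0 l : 0 <= mass l.
Proof. by rewrite sumr_ge0. Qed.

Lemma dur_rcons l p : dur (rcons l p) = dur l + p.1.
Proof. by rewrite /dur -cats1 big_cat big_seq1. Qed.

Lemma mass_rcons l p : mass (rcons l p) = mass l + `|p.2|.
Proof. by rewrite /mass -cats1 big_cat big_seq1. Qed.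

Lemma kicks_cat l l' z : kicks (l ++ l') z = kicks l' (kicks l z).
Proof. exact: foldl_cat. Qed.

Lemma kicks_rcons l p z : kicks (rcons l p) z = kick (kicks l z) p.
Proof. by rewrite -cats1 kicks_cat. Qed.

Lemma kick_linear p : 0 <= p.1 -> linear (kick ^~ p).
Proof.
move=> p0 a x y; rewrite /kick (lb_linear lB) -(qc_linear qS)//.
congr (S _ _); rewrite !scalerDr addrACA; congr (_ + _ + (_ + _)).
by rewrite !scalerA mulrC.
Qed.

Lemma kicks_linear l : forward l -> linear (kicks l).
Proof.
elim/last_ind: l => [|l p IH]; first by move=> _ a x y.
rewrite /forward all_rcons => /andP[p0 fl] a x y.
by rewrite !kicks_rcons IH// kick_linear.
Qed.

(** [1 + b |c| <= expR (b |c|)] puts impulse and flow into one exponent, so that along a list the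
    bounds multiply into total duration and total mass. *)
Lemma kick_bound p z : 0 <= p.1 ->
  `|kick z p| <= expR (w * p.1 + b * `|p.2|) * `|z|.
Proof.
move=> p0; apply: le_trans (qc_bound qS _ p0) _.
rewrite expRD -mulrA ler_wpM2l ?expR_ge0//.
apply: le_trans (ler_normD _ _) _; rewrite normrZ.
apply: (@le_trans _ _ ((1 + b * `|p.2|) * `|z|)).
  rewrite mulrDl mul1r lerD2l// -mulrA mulrCA ler_wpM2l//.
  exact: lb_bound.
by rewrite ler_wpM2r// expR_ge1Dx.
Qed.

Lemma kicks_bound l z : forward l ->
  `|kicks l z| <= expR (w * dur l + b * mass l) * `|z|.
Proof.
elim/last_ind: l => [|l p IH].
  by rewrite /dur /mass !big_nil !mulr0 addr0 expR0 mul1r.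
rewrite /forward all_rcons => /andP[p0 fl].
rewrite kicks_rcons; apply: le_trans (kick_bound _ p0) _.
rewrite dur_rcons mass_rcons.
have -> : w * (dur l + p.1) + b * (mass l + `|p.2|) =
  (w * p.1 + b * `|p.2|) + (w * dur l + b * mass l) by ring.
by rewrite [leRHS]mulrC [X in _ <= _ * X]expRD mulrCA ler_wpM2l ?expR_ge0// mulrC IH.
Qed.

Lemma kicks_boundW l z (T m : R) : forward l -> dur l <= T -> mass l <= m ->
  `|kicks l z| <= expR (w * T + b * m) * `|z|.
Proof.
move=> fl lT lm; apply: le_trans (kicks_bound _ fl) _.
by rewrite ler_wpM2r// ler_expR lerD// ler_wpM2l.
Qed.

Lemma qc_boundW (t T : R) x : 0 <= t -> t <= T -> `|S t x| <= expR (w * T) * `|x|.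
Proof.
move=> t0 tT; apply: le_trans (qc_bound qS _ t0) _.
by rewrite ler_wpM2r// ler_expR ler_wpM2l.
Qed.

(* A uniform modulus of continuity at the origin of time gives one at every
   time because S (s + r) - S s = S s (S r - 1). *)
Lemma totally_bounded_orbit A (T : R) : totally_bounded A ->
  totally_bounded [set y | exists (t : R) x, [/\ 0 <= t, t <= T, A x & y = S t x]].
Proof.
move=> tA; have [T0|T0] := ltP T 0.
  move=> e e0; exists [::] => y [t [x [t0 tT _ _]]].
  by have := le_lt_trans (le_trans t0 tT) T0; rewrite ltxx.
apply: totally_bounded_near => e e0; set c := expR (w * T).
have c0 : 0 < c by rewrite expR_gt0.
have [s sP] := tA (e / c) (divr_gt0 e0 c0).
exists [set y | exists (t : R) x, [/\ 0 <= t, t <= T, x \in s & y = S t x]]; last first.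
  move=> y [t [x [t0 tT /sP[x' x's xx'] ->]]]; exists (S t x'); first by exists t, x'.
  rewrite -(linB (qc_linear qS t0)); apply: le_trans (qc_boundW _ t0 tT) _.
  by rewrite -/c mulrC -ler_pdivlMr.
elim: s {sP} => [|x s IH]; first by move=> e' e'0; exists [::] => y [? [? []]].
move=> e' e'0; have [r rP] := IH _ e'0.
have [d d0 dP] := qc_continuous qS x (divr_gt0 e'0 c0).
pose n := (Num.truncn (T / d)).+1.
exists ([seq S (k%:R * d) x | k <- iota 0 n] ++ r) => y [t [x' [t0 tT]]].
rewrite inE => /orP[/eqP->|x's] ->; last first.
  have [y' yr ?] := rP (S t x') (ex_intro _ t (ex_intro _ x' (And4 t0 tT x's erefl))).
  by exists y' => //; rewrite mem_cat yr orbT.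
pose k := Num.truncn (t / d).
have /andP[k1 k2] : (k%:R <= t / d < k.+1%:R).
  by apply: truncn_itv; rewrite divr_ge0// ltW.
have kd : k%:R * d <= t by rewrite -ler_pdivlMr.
exists (S (k%:R * d) x).
  rewrite mem_cat; apply/orP; left; apply/mapP; exists k => //.
  rewrite mem_iota/= add0n ltnS; apply: le_truncn.
  by rewrite ler_pM2r ?invr_gt0.
have kd0 : 0 <= k%:R * d by rewrite mulr_ge0// ltW.
have -> : S t x = S (k%:R * d) (S (t - k%:R * d) x).
  by rewrite -(qc_addE _ qS) ?subr_ge0// subrKC.
rewrite -(linB (qc_linear qS kd0)).
apply: le_trans (qc_boundW _ kd0 (le_trans kd tT)) _.
rewrite -/c mulrC -ler_pdivlMr//; apply: dP.
move: k2; rewrite ltr_pdivrMr// -natr1 mulrDl mul1r => k2.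
by rewrite subr_ge0 kd lerBlDl addrC ltW//; lra.
Qed.

Lemma totally_bounded_lin A : totally_bounded A -> totally_bounded (B @` A).
Proof.
apply: (@totally_bounded_lipschitz _ _ _ _ b) => x y.
by rewrite -(linB (lb_linear lB)) (lb_bound lB).
Qed.

End Kicks.

(** * Total boundedness of the states reached by impulses *)

Section Outcomes.
Context (R : realType) (Y : completeNormedModType R).
Context (S : R -> Y -> Y) (w : R) (qS : quasi_contractive S w).
Context (B : Y -> Y) (b : R) (lB : lin_bounded B b).
Implicit Types (l : seq (R * R)) (x y z : Y) (A C : set Y).

Let w0 : 0 <= w := qc_ge0 qS.
Let b0 : 0 <= b := lb_ge0 lB.

Definition orbit A (T : R) : set Y :=
  [set y | exists (t : R) x, [/\ 0 <= t, t <= T, A x & y = S t x]].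

(** [T] and [m] are upper bounds, so that all the states met along a trajectory are outcomes too. *)
Definition outcomes (T m : R) A : set Y :=
  [set y | exists l z, [/\ forward l, dur l <= T, mass l <= m, A z
                         & y = kicks S B l z]].

Lemma abs_hull_orbit A (T t m : R) x : 0 <= t ->
  abs_hull (orbit A T) m x -> abs_hull (orbit A (T + t)) m (S t x).
Proof.
move=> t0; elim => [|{}m {}x c y _ IH [s [z [s0 sT Az ->]]]].
  by rewrite (lin0 (qc_linear qS t0)); constructor.
rewrite (linD (qc_linear qS t0)) (linZ (qc_linear qS t0)); constructor => //.
exists (t + s), z; split => //; first exact: addr_ge0.
  by rewrite addrC lerD2r.
by rewrite (qc_addE _ qS).
Qed.

(* Discrete form of x(t) = S t z + \int_0^t S (t - s) B x(s) u(s) ds, in which the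
   states x(s) under the integral are replaced by nearby points of C. *)
Lemma discrete_duhamel C l z (e lam T m : R) :
  0 <= e -> 0 < lam ->
  (forall l' : seq (R * R), forward l' -> dur l' <= T -> mass l' <= m ->
     exists2 y, C y & `|kicks S B l' z - y| <= e * expR (lam * mass l')) ->
  forward l -> dur l <= T -> mass l <= m ->
  exists2 h, abs_hull (orbit (B @` C) (dur l)) (mass l) h &
    `|kicks S B l z - (S (dur l) z + h)| <=
      expR (w * dur l) * (b * e / lam * expR (lam * mass l)).
Proof.
move=> e0 lam0 near; elim/last_ind: l => [_ _ _|l [t c] IH].
  exists 0; rewrite /dur /mass !big_nil; first exact: abs_hull0.
  rewrite (qc_id qS)/= addr0 subrr normr0.
  by rewrite mulr_ge0 ?expR_ge0// mulr_ge0 ?expR_ge0// divr_ge0 ?mulr_ge0// ltW.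
rewrite /forward all_rcons dur_rcons mass_rcons /= => /andP[t0 fl] lT lm.
have lT' : dur l <= T by lra.
have lm' : mass l <= m by have := normr_ge0 c; lra.
have [h hh kh] := IH fl lT' lm'; have [y Cy ky] := near l fl lT' lm'.
have d0 := dur_ge0 fl.
(* The state before the last impulse is replaced by its neighbour [y] in that impulse only; the
   older part [h] of the sum flows on for time [t]. *)
exists (S t h + c *: S t (B y)).
  constructor; first exact: abs_hull_orbit.
  by exists t, (B y); split => //; rewrite lerDr.
set k := kicks S B l z in kh ky *; set d := dur l in kh d0 *.
set E := expR (lam * mass l) in kh ky *.
have -> : kicks S B (rcons l (t, c)) z - (S (d + t) z + (S t h + c *: S t (B y)))
    = S t ((k - (S d z + h)) + c *: B (k - y)).
  have lS := qc_linear qS t0.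
  rewrite kicks_rcons /kick /= -/k [d + t]addrC (qc_addE _ qS)//.
  rewrite (linB (lb_linear lB)) !(linD lS, linN lS, linZ lS).
  by rewrite scalerBr [S t (S d z) + _]addrA opprD addrACA.
rewrite mulrDr expRD; apply: le_trans (qc_bound qS _ t0) _.
rewrite [expR (w * d) * _]mulrC -[leRHS]mulrA ler_wpM2l ?expR_ge0//.
have E0 : 0 <= E by rewrite expR_ge0.
have wd1 : 1 <= expR (w * d) by rewrite -expR0 ler_expR mulr_ge0.
apply: le_trans (ler_normD _ _) _; rewrite normrZ.
have Bk : `|B (k - y)| <= b * (e * E).
  by apply: le_trans (lb_bound lB _) _; rewrite ler_wpM2l.
(* Discrete form of [\int_0^M e^(lam s) ds <= e^(lam M) / lam]: an increase [|c|] of the mass is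
   absorbed by [1 + lam |c| <= e^(lam |c|)]. The exponential weight is what produces the factor
   [1 / lam]. *)
apply: (@le_trans _ _ (expR (w * d) * (b * e / lam * E * (1 + lam * `|c|)))).
  rewrite mulrDr mulr1 mulrDr; apply: lerD => //.
  have -> : b * e / lam * E * (lam * `|c|) = `|c| * (b * (e * E)).
    by field; rewrite gt_eqF.
  rewrite -[leLHS]mul1r; apply: ler_pM => //.
  by rewrite ler_wpM2l.
rewrite ler_wpM2l ?expR_ge0// [lam * (_ + _)]mulrDr expRD -/E mulrA.
rewrite ler_wpM2l ?expR_ge1Dx//.
by rewrite mulr_ge0// divr_ge0 ?mulr_ge0// ltW.
Qed.

(* If the outcomes are within e * expR (lam * mass) of a totally bounded set, then
   by Duhamel's formula they are within half of that of another such set. *)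
Lemma totally_bounded_outcomes (T m : R) A :
  totally_bounded A -> totally_bounded (outcomes T m A).
Proof.
move=> tA; set q := expR (w * T) * b.
have q0 : 0 <= q by rewrite mulr_ge0 ?expR_ge0.
(* [discrete_duhamel] multiplies the weighted distance by at most [q / lam], which is below 1/2 for
   this [lam]. *)
pose lam := q + q + 1; have lam0 : 0 < lam by rewrite /lam; lra.
pose claim (e : R) := exists2 C, totally_bounded C & forall l z,
  forward l -> dur l <= T -> mass l <= m -> A z ->
  exists2 y, C y & `|kicks S B l z - y| <= e * expR (lam * mass l).
have claimP (e : R) : 0 <= e -> claim e -> claim (e / 2).
  move=> e0 [C tC CP].
  exists [set x + y | x in orbit A T &
     y in [set x | exists2 m', m' <= m & abs_hull (orbit (B @` C) T) m' x]].
    apply: totally_boundedD; first exact: (totally_bounded_orbit qS).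
    apply: totally_bounded_hull; apply: (totally_bounded_orbit qS).
    exact: (totally_bounded_lin lB).
  move=> l z fl lT lm Az.
  have [h hh kh] := discrete_duhamel e0 lam0
    (fun l fl lT lm => CP l z fl lT lm Az) fl lT lm.
  exists (S (dur l) z + h).
    exists (S (dur l) z); first by exists (dur l), z; split => //; exact: dur_ge0.
    exists h => //; exists (mass l) => //; apply: sub_abs_hull hh.
    by move=> y [t [x [t0 tT Cx ->]]]; exists t, x; split => //; exact: le_trans lT.
  apply: le_trans kh _; rewrite mulrA ler_wpM2r ?expR_ge0//.
  apply: (@le_trans _ _ (q * e / lam)).
    rewrite /q -!mulrA; apply: ler_wpM2r.
      by rewrite mulr_ge0// divr_ge0// ltW.
    by rewrite ler_expR ler_wpM2l.
  by rewrite ler_pdivrMr// /lam; nra.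
have [M M0 MP] := totally_bounded_bounded tA.
pose e0 := expR (w * T + b * m) * M.
have e00 : 0 <= e0 by rewrite mulr_ge0 ?expR_ge0.
(* The iteration starts from the one-point set [{0}]: the outcomes are bounded and the exponential
   weight is at least 1. *)
have claim0 : claim e0.
  exists [set 0]; first exact: totally_bounded1.
  move=> l z fl lT lm Az; exists 0 => //; rewrite subr0.
  apply: le_trans (kicks_boundW qS lB z fl lT lm) _.
  apply: (@le_trans _ _ e0); first by rewrite ler_wpM2l ?expR_ge0// MP.
  by rewrite ler_peMr// -expR0 ler_expR mulr_ge0 ?mass_ge0// ltW.
have claimn n : claim (e0 / 2 ^+ n).
  elim: n => [|n IH]; first by rewrite expr0 divr1.
  by rewrite exprSr invfM mulrA; apply: claimP => //; rewrite divr_ge0.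
apply: totally_bounded_near => e e_gt0.
(* [n + 1] halvings suffice because [c < n + 1 <= 2 ^ (n + 1)]. *)
pose c := e0 * expR (lam * m) / e; pose n := Num.truncn c.
have c0 : 0 <= c by rewrite divr_ge0 ?mulr_ge0 ?expR_ge0// ltW.
have [C tC CP] := claimn n.+1; exists C => // _ [l [z [fl lT lm Az ->]]].
have [y Cy ky] := CP l z fl lT lm Az; exists y => //; apply: le_trans ky _.
have cn : c <= 2 ^+ n.+1.
  have /andP[_ /ltW cn] := truncn_itv c0; apply: le_trans cn _.
  by rewrite -/n -natrX ler_nat ltnW// ltn_expl.
rewrite mulrAC ler_pdivrMr ?exprn_gt0//.
apply: (@le_trans _ _ (e0 * expR (lam * m))).
  by rewrite ler_wpM2l// ler_expR ler_wpM2l// ltW.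
by rewrite [leRHS]mulrC -ler_pdivrMr.
Qed.

End Outcomes.

(** * Grouping the impulses of a short block *)

Section Blocks.
Context (R : realType) (Y : completeNormedModType R).
Context (S : R -> Y -> Y) (w : R) (qS : quasi_contractive S w).
Context (B : Y -> Y) (b : R) (lB : lin_bounded B b).
Implicit Types (l : seq (R * R)) (x y z : Y) (A : set Y).

Let w0 : 0 <= w := qc_ge0 qS.
Let b0 : 0 <= b := lb_ge0 lB.

Definition net l : R := \sum_(p <- l) p.2.

Lemma net_rcons l p : net (rcons l p) = net l + p.2.
Proof. by rewrite /net -cats1 big_cat big_seq1. Qed.

(** The operators [S t] with [t <= 1] are uniformly bounded, so their strong convergence can be
    checked on a finite net. *)
Lemma qc_continuous_tb A (e : R) : totally_bounded A -> 0 < e ->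
  exists2 d : R, 0 < d & forall t x, 0 <= t <= d -> A x -> `|S t x - x| <= e.
Proof.
move=> tA e0; set c := expR w.
have c0 : 0 < c by rewrite expR_gt0.
(* The terms [S t (x - y)] and [y - x] of the splitting cost [c * r] and [r], together [e / 3]. *)
pose r := e / (3 * (c + 1)).
have r0 : 0 < r by rewrite divr_gt0// mulr_gt0// addr_gt0.
have [s sP] := tA r r0.
have [d d0 dP] : exists2 d : R, 0 < d & forall t x, 0 <= t <= d -> x \in s ->
    `|S t x - x| <= e / 3.
  elim: s {sP} => [|x s [d d0 dP]]; first by exists 1.
  have [d' d'0 d'P] := qc_continuous qS x (divr_gt0 e0 (ltr0n _ 3)).
  exists (Num.min d d'); first by rewrite lt_min d0.
  move=> t y; rewrite le_min => /and3P[t0 td td'].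
  rewrite inE => /orP[/eqP->|ys]; first by rewrite d'P ?t0.
  by rewrite dP ?t0.
exists (Num.min d 1); first by rewrite lt_min d0/=.
move=> t x; rewrite le_min => /and3P[t0 td t1] /sP[y ys xy].
have -> : S t x - x = S t (x - y) + (S t y - y) + (y - x).
  by rewrite (linB (qc_linear qS t0)) !subrKA.
have h1 : `|S t (x - y)| <= c * r.
  apply: le_trans (qc_boundW qS _ t0 t1) _; rewrite mulr1.
  by rewrite ler_wpM2l// ltW.
have h2 : `|S t y - y| <= e / 3 by rewrite dP ?t0.
have h3 : (c + 1) * r = e / 3 by rewrite /r; field; rewrite gt_eqF// addr_gt0.
have := ler_normD (S t (x - y) + (S t y - y)) (y - x).
have := ler_normD (S t (x - y)) (S t y - y).
by rewrite (distrC y x); lra.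
Qed.

(** A crude comparison, linear in the mass: just before an impulse inside a short block, the state
    is still near that of the free flow. *)
Lemma kicks_free l z : forward l ->
  `|kicks S B l z - S (dur l) z| <=
    b * mass l * (expR (w * dur l + b * mass l) * `|z|).
Proof.
elim/last_ind: l => [_|l [t a] IH].
  by rewrite /dur /mass !big_nil (qc_id qS)/= subrr normr0 mulr0 mul0r.
rewrite /forward all_rcons dur_rcons mass_rcons/= => /andP[t0 fl].
have {}IH := IH fl; have lS := qc_linear qS t0; have dl0 := dur_ge0 fl.
rewrite kicks_rcons /kick/= [dur l + t]addrC (qc_addE _ qS)// -(linB lS) addrAC.
apply: le_trans (qc_bound qS _ t0) _.
set k := kicks S B l z in IH *; set E := expR (w * dur l + b * mass l) in IH *.
have Bk : `|a *: B k| <= b * `|a| * (E * `|z|).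
  rewrite normrZ [b * _]mulrC -mulrA ler_wpM2l//.
  apply: le_trans (lb_bound lB _) _.
  by rewrite ler_wpM2l//; exact: kicks_bound.
have -> : w * (t + dur l) + b * (mass l + `|a|) =
  w * t + (w * dur l + b * mass l) + b * `|a| by ring.
rewrite [expR (_ + _ + _)]expRD expRD -/E.
have a1 : 1 <= expR (b * `|a|) by rewrite -expR0 ler_expR mulr_ge0.
apply: (@le_trans _ _ (expR (w * t) * (b * (mass l + `|a|) * (E * `|z|)))).
  rewrite ler_wpM2l ?expR_ge0//; apply: le_trans (ler_normD _ _) _.
  by rewrite mulrDr mulrDl lerD.
have -> : b * (mass l + `|a|) * (expR (w * t) * E * expR (b * `|a|) * `|z|) =
   expR (w * t) * (b * (mass l + `|a|) * (E * `|z|)) * expR (b * `|a|) by ring.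
rewrite ler_peMr// !mulr_ge0 ?expR_ge0// addr_ge0 ?mass_ge0//.
Qed.

(** All impulses are moved to the start of the block. For an impulse [a] after time [dur l] this
    replaces [a *: B k] by [a *: S (dur l) (B z)]: the state [k] is within [r] of [S (dur l) z],
    which is within [r] of [z], and [B z] moves by at most [r]. The factor [|a|] makes the total
    error proportional to the mass. *)
Lemma block_bound l z (d m r : R) : forward l -> dur l <= d -> mass l <= m ->
  (forall t, 0 <= t <= d -> `|S t z - z| <= r) ->
  (forall t, 0 <= t <= d -> `|S t (B z) - B z| <= r) ->
  b * m * (expR (w * d + b * m) * `|z|) <= r ->
  `|kicks S B l z - S (dur l) (z + net l *: B z)| <=
    expR (w * dur l) * (b * (r + r) + r) * mass l.
Proof.
move=> + + + zr Bzr mr; elim/last_ind: l => [_ _ _|l [t a] IH].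
  rewrite /dur /mass /net !big_nil (qc_id qS)/= scale0r addr0 subrr normr0.
  by rewrite mulr0.
rewrite /forward all_rcons dur_rcons mass_rcons net_rcons/= => /andP[t0 fl] ld lm.
have a0 := normr_ge0 a; have dl0 := dur_ge0 fl; have ml0 := mass_ge0 l.
have ld' : dur l <= d by lra.
have lm' : mass l <= m by lra.
have {}IH := IH fl ld' lm'.
have lS := qc_linear qS t0; have lSd := qc_linear qS dl0.
have free : `|kicks S B l z - S (dur l) z| <= r.
  apply: le_trans (kicks_free z fl) _; apply: le_trans mr.
  apply: ler_pM; rewrite ?mulr_ge0 ?expR_ge0//; first by rewrite ler_wpM2l.
  by rewrite ler_wpM2r// ler_expR lerD// ler_wpM2l.
set k := kicks S B l z in free IH *.
have kz : `|B k - S (dur l) (B z)| <= b * (r + r) + r.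
  have -> : B k - S (dur l) (B z) = B (k - z) + (B z - S (dur l) (B z)).
    by rewrite (linB (lb_linear lB)) subrKA.
  apply: le_trans (ler_normD _ _) _; apply: lerD; last first.
    by rewrite distrC Bzr// dl0.
  apply: le_trans (lb_bound lB _) _; rewrite ler_wpM2l//.
  apply: le_trans (ler_distD (S (dur l) z) _ _) _; apply: lerD => //.
  by rewrite zr// dl0.
have -> : kicks S B (rcons l (t, a)) z - S (dur l + t) (z + (net l + a) *: B z) =
    S t ((k - S (dur l) (z + net l *: B z)) + a *: (B k - S (dur l) (B z))).
  rewrite kicks_rcons /kick/= -/k [dur l + t]addrC (qc_addE _ qS)// -(linB lS).
  congr (S t _); rewrite scalerDl addrA (linD lSd) (linZ lSd a) opprD addrACA.
  by rewrite scalerBr.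
set q := b * (r + r) + r in kz IH *.
apply: le_trans (qc_bound qS _ t0) _; rewrite [w * (_ + _)]mulrDr expRD.
rewrite [expR (w * dur l) * _]mulrC -!mulrA ler_wpM2l ?expR_ge0//.
apply: le_trans (ler_normD _ _) _; rewrite normrZ !mulrDr; apply: lerD.
  by move: IH; rewrite -!mulrA.
have e1 : 1 <= expR (w * dur l) by rewrite -expR0 ler_expR mulr_ge0.
rewrite mulrA [leLHS]mulrC; apply: ler_wpM2r => //.
have q0 : 0 <= q := le_trans (normr_ge0 _) kz.
by apply: le_trans kz _; rewrite ler_peMl.
Qed.

(** A bound [e * mass l], unlike a bound [e], can be summed over the blocks of a subdivision of any
    fineness. Total boundedness of [A] and of its image under [B] makes [d] uniform in the state. *)
Lemma block_error A (e : R) : totally_bounded A -> 0 < e ->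
  exists2 d : R, 0 < d & forall l z, forward l -> A z -> dur l <= d ->
    mass l <= d ->
    `|kicks S B l z - S (dur l) (z + net l *: B z)| <= e * mass l.
Proof.
move=> tA e0; set c := expR w; have c0 : 0 < c by rewrite expR_gt0.
have [M M0 MP] := totally_bounded_bounded tA.
have b1 : 0 < 2 * b + 1 by rewrite ltr_wpDl// mulr_ge0.
(* Chosen so that [c * (b * (r + r) + r) = e], the constant of [block_bound] for durations at most
   1. *)
pose r := e / (c * (2 * b + 1)).
have r0 : 0 < r by rewrite divr_gt0// mulr_gt0.
have [d1 d10 d1P] := qc_continuous_tb tA r0.
have [d2 d20 d2P] := qc_continuous_tb (totally_bounded_lin lB tA) r0.
pose N := b * (expR (w + b) * M).
have N0 : 0 <= N by rewrite !mulr_ge0 ?expR_ge0.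
have N1 : 0 < N + 1 by rewrite ltr_wpDl.
pose d := Num.min (Num.min d1 d2) (Num.min 1 (r / (N + 1))).
have d0 : 0 < d by rewrite !lt_min d10 d20 ltr01 divr_gt0.
have : d <= d by []; rewrite {2}/d !le_min => /andP[/andP[dd1 dd2] /andP[dle1 dr]].
exists d => // l z fl Az ld lm.
have H : `|kicks S B l z - S (dur l) (z + net l *: B z)| <=
    expR (w * dur l) * (b * (r + r) + r) * mass l.
  apply: (@block_bound l z d d) => //.
  - by move=> t /andP[t0 td]; rewrite d1P// t0 (le_trans td).
  - by move=> t /andP[t0 td]; rewrite d2P ?t0 ?(le_trans td)//; exists z.
  - apply: (@le_trans _ _ (N * d)); last first.
      move: dr; rewrite ler_pdivlMr// => dr; apply: le_trans dr.
      by rewrite mulrC ler_wpM2l ?(ltW d0)// lerDl.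
    rewrite /N mulrAC ler_wpM2r ?(ltW d0)// ler_wpM2l//.
    apply: ler_pM; rewrite ?expR_ge0// ?MP// ler_expR.
    by rewrite lerD// ler_piMr.
apply: le_trans H _; rewrite ler_wpM2r ?mass_ge0//.
have -> : e = c * (b * (r + r) + r).
  by rewrite /r; field; rewrite !gt_eqF.
have r0' := ltW r0; apply: ler_wpM2r.
  by apply: addr_ge0 => //; apply: mulr_ge0 => //; exact: addr_ge0.
by rewrite ler_expR ler_piMr//; exact: le_trans dle1.
Qed.

End Blocks.

(** * Propagators as limits over subdivisions *)

Section Partitions.
Context (R : realType).
Implicit Types (a b c d x : R) (s : seq R).

(* [s] lists the points other than [a] of a subdivision of [[a, c]]. *)
Definition partition_of a c s : bool := path <%R a s && (last a s == c).

Definition mesh d a s : bool := path (fun x y => y <= x + d) a s.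

Lemma partition_le a c s : partition_of a c s -> a <= c.
Proof.
move=> /andP[]; elim: s a => [a _ /eqP<-//|p s IH a /= /andP[ap ps] pc].
exact: le_trans (ltW ap) (IH _ ps pc).
Qed.

Lemma partition_mem a c s x : partition_of a c s -> x \in s -> a < x <= c.
Proof.
elim: s a => // p s IH a /andP[/= /andP[ap ps] pc].
have P : partition_of p c s by rewrite /partition_of ps.
rewrite inE => /orP[/eqP->|/(IH _ P)/andP[px ->]]; last by rewrite (lt_trans ap).
by rewrite ap (partition_le P).
Qed.

Lemma partition_cat a b c s s' :
  partition_of a b s -> partition_of b c s' -> partition_of a c (s ++ s').
Proof.
move=> /andP[ps /eqP sb] /andP[ps' /eqP sc].
by rewrite /partition_of cat_path last_cat sb ps ps' sc eqxx.
Qed.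

Lemma mesh_cat d a b s s' : partition_of a b s ->
  mesh d a s -> mesh d b s' -> mesh d a (s ++ s').
Proof. by move=> /andP[_ /eqP sb] ms ms'; rewrite /mesh cat_path sb; apply/andP. Qed.

Lemma meshS d d' a s : d <= d' -> mesh d a s -> mesh d' a s.
Proof.
by move=> dd'; apply: sub_path => x y /= /le_trans; apply; rewrite lerD2l.
Qed.

Lemma partition_exists d a c : 0 < d -> a <= c ->
  exists2 s, partition_of a c s & mesh d a s.
Proof.
move=> d0 ac; have [n] : exists n : nat, c <= a + n%:R * d.
  exists (Num.truncn ((c - a) / d)).+1.
  have /andP[_] : (Num.truncn ((c - a) / d))%:R <= (c - a) / d
      < (Num.truncn ((c - a) / d)).+1%:R.
    by apply: truncn_itv; rewrite divr_ge0 ?subr_ge0// ltW.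
  by rewrite ltr_pdivrMr//; lra.
elim: n a ac => [|n IH] a ac.
  rewrite mul0r addr0 => ca; exists [::] => //; rewrite /partition_of /=.
  by rewrite eq_le ac.
rewrite -natr1 mulrDl mul1r => cn; have [cd|cd] := leP c (a + d).
  have [->|ac'] := eqVneq a c; first by exists [::] => //; rewrite /partition_of/=.
  exists [:: c]; last by rewrite /mesh /= cd.
  by rewrite /partition_of /= eqxx lt_neqAle ac' ac.
have [||s ps ms] := IH (a + d); [exact: ltW|lra|].
exists (a + d :: s); last by rewrite /mesh /= lexx.
by rewrite /partition_of /= ltrDl d0.
Qed.

Lemma partition_refine a c s s' : partition_of a c s -> partition_of a c s' ->
  exists s'', [/\ partition_of a c s'', {subset s <= s''} & {subset s' <= s''}].
Proof.
move=> ps ps'; pose r := sort <=%R (undup (s ++ s')).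
have rE x : (x \in r) = (x \in s) || (x \in s').
  by rewrite mem_sort mem_undup mem_cat.
exists r; split => [|x xs|x xs]; rewrite ?rE ?xs ?orbT//.
have ra x : x \in r -> a < x <= c.
  by rewrite rE => /orP[] /partition_mem; apply.
have pr : path <%R a r.
  rewrite path_sortedE; last exact: lt_trans.
  rewrite sort_lt_sorted undup_uniq andbT; apply/allP => x /ra /andP[]//.
apply/andP; split => //; rewrite eq_le.
have lastr : last a r <= c.
  have := mem_last a r; rewrite inE => /orP[/eqP->|/ra/andP[]//].
  exact: partition_le ps.
rewrite lastr/=.
have cin : c \in a :: r.
  move: ps => /andP[_ /eqP <-]; have := mem_last a s.
  by rewrite !inE => /orP[->//|xs]; rewrite rE xs orbT.
elim: (r) a pr cin {ps ps' rE ra lastr} => [|p q IH] a' /=.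
  by move=> _; rewrite inE => /eqP->.
move=> /andP[ap pq]; rewrite inE => /orP[/eqP ->|]; last exact: IH.
apply: le_trans (ltW ap) _; apply: (@partition_le p (last p q) q).
by rewrite /partition_of pq eqxx.
Qed.

Variable U : R -> R.

(* When U is a primitive of the control u, this concentrates u, on each interval
   of the subdivision, into an impulse at the left end. *)
Fixpoint increments a s : seq (R * R) :=
  if s is p :: s' then (p - a, U p - U a) :: increments p s' else [::].

Lemma increments_cat a s s' :
  increments a (s ++ s') = increments a s ++ increments (last a s) s'.
Proof. by elim: s a => //= p s IH a; rewrite IH. Qed.

Lemma forward_increments a s : path <%R a s -> forward (increments a s).
Proof.
by elim: s a => //= p s IH a /andP[ap /IH ->]; rewrite subr_ge0 ltW.
Qed.

Lemma dur_increments a s : dur (increments a s) = last a s - a.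
Proof.
elim: s a => [|p s IH] a /=; first by rewrite /dur big_nil subrr.
by rewrite /dur big_cons -/(dur _) IH addrC subrKA.
Qed.

Lemma net_increments a s : net (increments a s) = U (last a s) - U a.
Proof.
elim: s a => [|p s IH] a /=; first by rewrite /net big_nil subrr.
by rewrite /net big_cons -/(net _) IH addrC subrKA.
Qed.

(* In the application U and V are primitives of u and |u|. *)
Definition dominated_on a c (V : R -> R) : Prop :=
  forall x y, a <= x -> x <= y -> y <= c -> `|U y - U x| <= V y - V x.

Lemma dominated_on_sub a c a' c' V : a <= a' -> c' <= c ->
  dominated_on a c V -> dominated_on a' c' V.
Proof.
by move=> aa cc dV x y ax xy yc; apply: dV => //; [exact: le_trans ax|exact: le_trans cc].
Qed.

Lemma dominated_on_le a c V : dominated_on a c V ->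
  forall x y, a <= x -> x <= y -> y <= c -> V x <= V y.
Proof. by move=> dV x y ax xy yc; rewrite -subr_ge0 (le_trans _ (dV x y _ _ _)). Qed.

Lemma mass_increments a c V s : dominated_on a c V -> partition_of a c s ->
  mass (increments a s) <= V c - V a.
Proof.
elim: s a => [|p s IH] a dV P /=.
  by rewrite /mass big_nil; have /andP[_ /eqP<-] := P; rewrite subrr.
have /andP[/= /andP[ap ps] pc] := P.
have P' : partition_of p c s by rewrite /partition_of ps.
have pc' := partition_le P'.
rewrite /mass big_cons -/(mass _)/= addrC -[leRHS](subrKA (V p)).
apply: lerD; last by apply: dV => //; exact: ltW.
by apply: IH => //; apply: dominated_on_sub dV => //; exact: ltW.
Qed.

End Partitions.

Lemma increments_shift (R : realType) (U U' : R -> R) (a c r : R) (s : seq R) :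
  (forall t u, a <= t -> t <= u -> u <= c -> U' (u + r) - U' (t + r) = U u - U t) ->
  partition_of a c [seq t - r | t <- s] ->
  increments U' (a + r) s = increments U a [seq t - r | t <- s].
Proof.
elim: s a => //= p s IH a UU' P'.
have /andP[ap pc] : a < p - r <= c by exact: partition_mem P' (mem_head _ _).
congr ((_, _) :: _); first by rewrite opprD addrA addrAC.
  by rewrite -UU' ?lexx ?(ltW ap)// subrK.
rewrite -IH ?subrK//; last by move: P'; rewrite /partition_of/= => /andP[/andP[_ ->]].
by move=> t u pt; apply: UU'; apply: le_trans pt; exact: ltW.
Qed.

Section Propagation.
Context (R : realType) (Y : completeNormedModType R).
Context (S : R -> Y -> Y) (w : R) (qS : quasi_contractive S w).
Context (B : Y -> Y) (b : R) (lB : lin_bounded B b).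
Implicit Types (z : Y) (U V W : R -> R) (a c : R) (s : seq R).

Let w0 : 0 <= w := qc_ge0 qS.
Let b0 : 0 <= b := lb_ge0 lB.

Definition euler U a s : Y -> Y := kicks S B (increments U a s).

Lemma euler_cat U a s s' z :
  euler U a (s ++ s') z = euler U (last a s) s' (euler U a s z).
Proof. by rewrite /euler increments_cat kicks_cat. Qed.

Lemma euler_linear U a c s : partition_of a c s -> linear (euler U a s).
Proof. by move=> /andP[ps _]; apply: (kicks_linear qS lB); exact: forward_increments. Qed.

Lemma euler_bound U V a c s z : dominated_on U a c V -> partition_of a c s ->
  `|euler U a s z| <= expR (w * (c - a) + b * (V c - V a)) * `|z|.
Proof.
move=> dV P; have /andP[ps /eqP sc] := P.
apply: (kicks_boundW qS lB); first exact: forward_increments.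
  by rewrite dur_increments sc.
exact: mass_increments.
Qed.

(** In the application, this is the absolute continuity of the integral of the control. There is no
    absolute value because a dominating [V] is nondecreasing. *)
Definition uniform_on V a c : Prop := forall e : R, 0 < e ->
  exists2 d : R, 0 < d & forall x y, a <= x -> x <= y -> y <= c -> y <= x + d ->
    V y - V x <= e.

Lemma uniform_on_sub V a c a' c' : a <= a' -> c' <= c ->
  uniform_on V a c -> uniform_on V a' c'.
Proof.
move=> aa cc uV e /uV[d d0 dP]; exists d => // x y ax xy yc; apply: dP => //.
  exact: le_trans ax.
exact: le_trans cc.
Qed.

(** Induction over the coarse intervals along the fine trajectory: on each of them the fine impulses
    are grouped into one, at a cost [e * (V p - V a)], and the coarse scheme carries this error to
    [c]. The list [l] is the history of the fine trajectory from [z0]; it guarantees that every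
    state met is an outcome, where the block estimate applies. *)
Lemma refine_error U V (z0 : Y) (T m e d d' : R) a c s s' l z :
  0 <= e -> d' <= d ->
  (forall l z, forward l -> outcomes S B T m [set z0] z -> dur l <= d ->
     mass l <= d -> `|kicks S B l z - S (dur l) (z + net l *: B z)| <= e * mass l) ->
  (forall x y, a <= x -> x <= y -> y <= c -> y <= x + d' -> V y - V x <= d) ->
  dominated_on U a c V ->
  partition_of a c s -> mesh d' a s -> partition_of a c s' -> {subset s <= s'} ->
  forward l -> z = kicks S B l z0 ->
  dur l + (c - a) <= T -> mass l + (V c - V a) <= m ->
  `|euler U a s' z - euler U a s z| <= expR (w * T + b * m) * (e * (V c - V a)).
Proof.
move=> e0 dd block + + + + + ss'.
elim: s a s' l z ss' => [|p s IH] a s' l z ss' Vd dV P ms P' fl zE lT lm.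
  move: P => /andP[_ /eqP/= ac]; case: s' P' {ss'} => [_|q s' P'].
    by rewrite subrr normr0 ac subrr !mulr0.
  have := @partition_mem _ _ _ _ q P'; rewrite mem_head ac => /(_ isT)/andP[h1 h2].
  by have := lt_le_trans h1 h2; rewrite ltxx.
have ps' : p \in s' by rewrite ss' ?mem_head.
have /andP[/= /andP[ap ps] sc] := P.
have Pp : partition_of p c s by rewrite /partition_of ps.
have pc := partition_le Pp; have apW := ltW ap.
(* The fine subdivision passes through the first coarse point [p]: [rcons s1 p] subdivides [[a, p]]
   and [s2] the rest. *)
case/splitPr: ps' ss' P' => s1 s2 ss' P'.
have [P1 P2] : partition_of a p (rcons s1 p) /\ partition_of p c s2.
  move: P'; rewrite /partition_of cat_path last_cat /= => /andP[/and3P[h1 h2 h3] h4].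
  by rewrite rcons_path last_rcons h1 h2 eqxx h3 h4.
have dVp : dominated_on U p c V by apply: dominated_on_sub dV.
have dVa : dominated_on U a p V by apply: dominated_on_sub dV.
move: ms; rewrite /mesh/= => /andP[pd ms].
set l1 := increments U a (rcons s1 p).
have fl1 : forward l1 by apply: forward_increments; case/andP: P1.
have d1 : dur l1 = p - a by rewrite dur_increments last_rcons.
have n1 : net l1 = U p - U a by rewrite net_increments last_rcons.
have m1 : mass l1 <= V p - V a by apply: mass_increments P1.
have Vpc : 0 <= V c - V p by rewrite subr_ge0 (dominated_on_le dV).
have Vap : 0 <= V p - V a by rewrite subr_ge0 (dominated_on_le dV).
have zout : outcomes S B T m [set z0] z.
  exists l, z0; split => //.
    by apply: le_trans lT; rewrite lerDl subr_ge0 (le_trans apW).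
  by apply: le_trans lm; rewrite lerDl -(subrKA (V p)) addr_ge0.
have step : `|euler U a (rcons s1 p) z - euler U a [:: p] z| <= e * (V p - V a).
  have := block l1 z fl1 zout; rewrite d1 n1 => step.
  apply: le_trans (step _ _) _.
  - by rewrite lerBlDl (le_trans pd)// lerD2l.
  - by apply: le_trans m1 _; exact: Vd.
  - by rewrite ler_wpM2l.
rewrite -cat_rcons euler_cat last_rcons -cat1s [euler U a ([:: p] ++ s) z]euler_cat /=.
set z1 := euler U a (rcons s1 p) z in step *.
set z2 := euler U a [:: p] z in step *.
have Epq : expR (w * (c - p) + b * (V c - V p)) <= expR (w * T + b * m).
  rewrite ler_expR lerD// ler_wpM2l//.
    by have := dur_ge0 fl; lra.
  by have := mass_ge0 l; lra.
have -> : euler U p s2 z1 - euler U p s z2 =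
    (euler U p s2 z1 - euler U p s z1) + (euler U p s z1 - euler U p s z2).
  by rewrite subrKA.
apply: le_trans (ler_normD _ _) _.
have -> : e * (V c - V a) = e * (V c - V p) + e * (V p - V a) by ring.
rewrite mulrDr; apply: lerD; last first.
  rewrite -(linB (euler_linear U Pp)); apply: le_trans (euler_bound _ dVp Pp) _.
  by apply: ler_pM; rewrite ?expR_ge0.
apply: (IH p s2 (l ++ l1) z1) => //.
- move=> q qs; have := ss' q.
  rewrite inE qs orbT mem_cat inE => /(_ isT)/or3P[qs1| /eqP qp|//].
    have /andP[pq _] := partition_mem Pp qs.
    have : q \in rcons s1 p by rewrite mem_rcons inE qs1 orbT.
    by move=> /(partition_mem P1)/andP[_ /(lt_le_trans pq)]; rewrite ltxx.
  by have := partition_mem Pp qs; rewrite qp ltxx.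
- by move=> x y px; apply: Vd; exact: le_trans px.
- by rewrite /forward all_cat; apply/andP.
- by rewrite kicks_cat -zE.
- by move: lT; rewrite /dur big_cat -!/(dur _)/= d1; lra.
- by move: lm; rewrite /mass big_cat -!/(mass _)/=; lra.
Qed.

(** Neither of two fine subdivisions need refine the other; each is compared with a common
    refinement, at a cost of [e / 2]. *)
Lemma euler_cauchy U V a c z (e : R) : dominated_on U a c V -> uniform_on V a c ->
  0 < e -> exists2 d : R, 0 < d & forall s s',
    partition_of a c s -> mesh d a s -> partition_of a c s' -> mesh d a s' ->
    `|euler U a s z - euler U a s' z| <= e.
Proof.
move=> dV uV e0; have [ac|ca] := leP a c; last first.
  exists 1 => // s s' /partition_le ac.
  by have := le_lt_trans ac ca; rewrite ltxx.
set T := c - a; set m := V c - V a.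
have m0 : 0 <= m by rewrite subr_ge0 (dominated_on_le dV).
pose K := expR (w * T + b * m) * (m + 1).
have K0 : 0 < K by rewrite mulr_gt0 ?expR_gt0// ltr_wpDl.
pose r := e / (2 * K); have r0 : 0 < r by rewrite divr_gt0// mulr_gt0.
have tA := totally_bounded_outcomes qS lB T m (totally_bounded1 z).
have [d d0 dP] := block_error qS lB tA r0.
have [d' d'0 d'P] := uV _ d0.
have ref s s' : partition_of a c s -> mesh (Num.min d d') a s ->
    partition_of a c s' -> {subset s <= s'} ->
    `|euler U a s' z - euler U a s z| <= e / 2.
  move=> P ms P' ss'.
  apply: le_trans (@refine_error U V z T m r d (Num.min d d') a c s s' [::] z
    _ _ dP _ dV P ms P' ss' _ _ _ _) _ => //.
  - exact: ltW.
  - by rewrite ge_min lexx.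
  - move=> x y ax xy yc yx; apply: d'P => //; apply: le_trans yx _.
    by rewrite lerD2l ge_min lexx orbT.
  - by rewrite /dur big_nil add0r.
  - by rewrite /mass big_nil add0r.
  - have -> : e / 2 = expR (w * T + b * m) * (r * (m + 1)).
      by rewrite /r /K; field; rewrite !gt_eqF ?expR_gt0// ltr_wpDl.
    rewrite ler_wpM2l ?expR_ge0// ler_wpM2l ?lerDl//; exact: ltW.
exists (Num.min d d'); first by rewrite lt_min d0.
move=> s s' P ms P' ms'; have [s'' [P'' s1 s2]] := partition_refine P P'.
have h1 := ref _ _ P ms P'' s1; have h2 := ref _ _ P' ms' P'' s2.
apply: le_trans (ler_distD (euler U a s'' z) _ _) _.
by move: h1; rewrite (distrC _ (euler U a s z)); lra.
Qed.

Definition mesh_filter a c : set_system (seq R) :=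
  filter_from [set d : R | 0 < d] (fun d => [set s | partition_of a c s && mesh d a s]).

Lemma mesh_filter_proper a c : a <= c -> ProperFilter (mesh_filter a c).
Proof.
move=> ac; apply: filter_from_proper; last first.
  by move=> d /= d0; have [s P ms] := partition_exists d0 ac; exists s; rewrite /= P.
apply: filter_from_filter; first by exists 1 => /=.
move=> d d' /= d0 d'0; exists (Num.min d d'); first by rewrite /= lt_min d0.
move=> s /= /andP[-> ms]; split; apply: meshS ms; rewrite ge_min lexx//.
by rewrite orbT.
Qed.

Definition propagate U a c z : Y := lim (euler U a s z @[s --> mesh_filter a c]).

Lemma propagate_cvg U V a c z : a <= c -> dominated_on U a c V ->
  uniform_on V a c ->
  euler U a s z @[s --> mesh_filter a c] --> propagate U a c z.
Proof.
move=> ac dV uV; have pF := mesh_filter_proper ac.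
apply: cauchy_cvg; apply: cauchy_exP => e e0.
have [d d0 dP] := euler_cauchy z dV uV (divr_gt0 e0 (ltr0n _ 2)).
have [s P ms] := partition_exists d0 ac.
exists (euler U a s z); exists d => // s' /= /andP[P' ms'].
rewrite -ball_normE /=; apply: le_lt_trans (dP _ _ P ms P' ms') _.
by rewrite ltr_pdivrMr// ltr_pMr// ltr1n.
Qed.

End Propagation.

(** * Algebraic properties and estimates of the limit propagator *)

Section PropagateTheory.
Context (R : realType) (Y : completeNormedModType R).
Context (S : R -> Y -> Y) (w : R) (qS : quasi_contractive S w).
Context (B : Y -> Y) (b : R) (lB : lin_bounded B b).
Implicit Types (z : Y) (U V W : R -> R) (a c : R) (s : seq R).

Let w0 : 0 <= w := qc_ge0 qS.
Let b0 : 0 <= b := lb_ge0 lB.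

Local Notation eul := (euler S B).
Local Notation prop := (propagate S B).

Lemma propagate_near U V a c z (e : R) : a <= c -> dominated_on U a c V ->
  uniform_on V a c -> 0 < e ->
  exists2 d : R, 0 < d & forall s, partition_of a c s -> mesh d a s ->
    `|eul U a s z - prop U a c z| <= e.
Proof.
move=> ac dV uV e0; have pF := mesh_filter_proper ac.
have /cvgrPdist_le/(_ e e0)[d d0 dP] := propagate_cvg qS lB (z:=z) ac dV uV.
by exists d => // s P ms; rewrite distrC; apply: dP; rewrite /= P.
Qed.

Lemma propagate_le U V a c z q (M d : R) : a <= c -> dominated_on U a c V ->
  uniform_on V a c -> 0 < d ->
  (forall s, partition_of a c s -> mesh d a s -> `|eul U a s z - q| <= M) ->
  `|prop U a c z - q| <= M.
Proof.
move=> ac dV uV d0 H; apply/ler_addgt0Pr => e e0.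
have [d' d'0 d'P] := propagate_near z ac dV uV e0.
have m0 : 0 < Num.min d d' by rewrite lt_min d0.
have [s P ms] := partition_exists m0 ac.
have h1 : `|eul U a s z - q| <= M.
  by apply: H => //; apply: meshS ms; rewrite ge_min lexx.
have h2 : `|eul U a s z - prop U a c z| <= e.
  by apply: d'P => //; apply: meshS ms; rewrite ge_min lexx orbT.
have := ler_distD (eul U a s z) (prop U a c z) q.
have {}h2 : `|prop U a c z - eul U a s z| <= e by rewrite distrC.
lra.
Qed.

Lemma propagate_eq U V a c z q : a <= c -> dominated_on U a c V ->
  uniform_on V a c ->
  (forall e : R, 0 < e -> exists2 d : R, 0 < d & forall s,
     partition_of a c s -> mesh d a s -> `|eul U a s z - q| <= e) ->
  prop U a c z = q.
Proof.
move=> ac dV uV H; apply/eqP; rewrite -subr_eq0 -normr_le0.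
apply/ler_addgt0Pr => e e0; rewrite add0r; have [d d0 dP] := H e e0.
exact: propagate_le ac dV uV d0 dP.
Qed.

Lemma propagate_bound U V a c z : a <= c -> dominated_on U a c V ->
  uniform_on V a c ->
  `|prop U a c z| <= expR (w * (c - a) + b * (V c - V a)) * `|z|.
Proof.
move=> ac dV uV; rewrite -[prop _ _ _ _]subr0.
apply: (propagate_le ac dV uV ltr01) => s P _; rewrite subr0.
exact: (euler_bound qS lB).
Qed.

Lemma propagate_linear U V a c : a <= c -> dominated_on U a c V ->
  uniform_on V a c -> linear (prop U a c).
Proof.
move=> ac dV uV k x y; apply: (propagate_eq ac dV uV) => e e0.
have k0 : 0 < `|k| + 1 by rewrite ltr_wpDl.
have [d d0 dP] := propagate_near x ac dV uV (divr_gt0 (divr_gt0 e0 (ltr0n _ 2)) k0).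
have [d' d'0 d'P] := propagate_near y ac dV uV (divr_gt0 e0 (ltr0n _ 2)).
exists (Num.min d d'); first by rewrite lt_min d0.
move=> s P ms; rewrite (euler_linear qS lB U P) opprD addrACA -scalerBr.
have h1 : `|eul U a s x - prop U a c x| <= e / 2 / (`|k| + 1).
  by apply: dP => //; apply: meshS ms; rewrite ge_min lexx.
have h2 : `|eul U a s y - prop U a c y| <= e / 2.
  by apply: d'P => //; apply: meshS ms; rewrite ge_min lexx orbT.
apply: le_trans (ler_normD _ _) _; rewrite [e]splitr; apply: lerD => //.
rewrite normrZ; apply: le_trans (ler_wpM2l (normr_ge0 k) h1) _.
rewrite mulrCA ler_piMr ?divr_ge0 ?(ltW e0)//.
by rewrite ler_pdivrMr// mul1r lerDl.
Qed.

(* Used with J the multiplication by a scalar of a larger field. *)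
Lemma propagate_comm U V a c z (J : Y -> Y) (k : R) : a <= c ->
  dominated_on U a c V -> uniform_on V a c ->
  linear J -> (forall x, `|J x| <= k * `|x|) ->
  (forall t x, 0 <= t -> S t (J x) = J (S t x)) -> (forall x, B (J x) = J (B x)) ->
  prop U a c (J z) = J (prop U a c z).
Proof.
move=> ac dV uV lJ Jk JS JB; apply: (propagate_eq ac dV uV) => e e0.
have k0 : 0 < `|k| + 1 by rewrite ltr_wpDl.
have [d d0 dP] := propagate_near z ac dV uV (divr_gt0 e0 k0).
exists d => // s P ms.
have eJ l x : forward l -> kicks S B l (J x) = J (kicks S B l x).
  elim/last_ind: l => [//|l [t u] IH].
  rewrite /forward all_rcons /= => /andP[t0 /IH {}IH].
  by rewrite !kicks_rcons IH /kick /= JB -(linZ lJ) -(linD lJ) JS.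
have /andP[ps _] := P.
rewrite /euler eJ ?forward_increments// -(linB lJ).
apply: le_trans (Jk _) _; have := dP s P ms; rewrite ler_pdivlMr//.
rewrite mulrC => /(le_trans _); apply; rewrite ler_wpM2r//.
by have := ler_norm k; lra.
Qed.

Lemma propagate_id U a : prop U a a = id.
Proof.
(* On [[a, a]] every [U] dominates itself, and the empty list is the only subdivision. *)
apply/funext => z; apply: (@propagate_eq U U a a) => //.
- move=> t u at' tu ua.
  by rewrite (le_anti (introT andP (conj tu (le_trans ua at')))) !subrr normr0.
- move=> e e0; exists 1 => // t u at' tu ua _.
  by rewrite (le_anti (introT andP (conj tu (le_trans ua at')))) subrr ltW.
- move=> e e0; exists 1 => // -[|p s] P _; first by rewrite /= subrr normr0 ltW.
  have := partition_mem P (mem_head _ _) => /andP[h1 h2].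
  by have := lt_le_trans h1 h2; rewrite ltxx.
Qed.

(** Fine subdivisions of [[a, c]] and [[c, c']] concatenate to a fine one of [[a, c']], along which
    all three limits are approximated; the error made up to [c] is amplified by at most [K]. *)
Lemma propagate_cocycle U V a c c' z : a <= c -> c <= c' ->
  dominated_on U a c' V -> uniform_on V a c' ->
  prop U a c' z = prop U c c' (prop U a c z).
Proof.
move=> ac cc' dV uV.
have dV1 : dominated_on U a c V by apply: dominated_on_sub dV.
have dV2 : dominated_on U c c' V by apply: dominated_on_sub dV.
have uV1 : uniform_on V a c by apply: uniform_on_sub uV.
have uV2 : uniform_on V c c' by apply: uniform_on_sub uV.
have ac' := le_trans ac cc'.
set y := prop U a c z.
apply/eqP; rewrite -subr_eq0 -normr_le0; apply/ler_addgt0Pr => e e0.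
rewrite add0r.
pose K := expR (w * (c' - c) + b * (V c' - V c)).
have K0 : 0 < K by rewrite expR_gt0.
have e30 : 0 < e / 3 by rewrite divr_gt0.
have [d1 d10 d1P] := propagate_near z ac dV1 uV1 (divr_gt0 e30 K0).
have [d2 d20 d2P] := propagate_near y cc' dV2 uV2 e30.
have [d3 d30 d3P] := propagate_near z ac' dV uV e30.
pose d := Num.min d1 (Num.min d2 d3).
have d0 : 0 < d by rewrite !lt_min d10 d20.
have [dd1 dd2 dd3] : [/\ d <= d1, d <= d2 & d <= d3].
  by split; rewrite /d !ge_min lexx ?orbT.
have [s P ms] := partition_exists d0 ac.
have [s' P' ms'] := partition_exists d0 cc'.
have h1 := d1P s P (meshS dd1 ms); have h2 := d2P s' P' (meshS dd2 ms').
have := d3P (s ++ s') (partition_cat P P') (meshS dd3 (mesh_cat P ms ms')).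
rewrite euler_cat; have /andP[_ /eqP->] := P.
set x := eul U a s z in h1 *.
have h4 : `|eul U c s' x - eul U c s' y| <= e / 3.
  rewrite -(linB (euler_linear qS lB U P')).
  apply: le_trans (euler_bound qS lB _ dV2 P') _.
  by rewrite -/K mulrC -ler_pdivlMr.
have -> : prop U a c' z - prop U c c' y =
   (prop U a c' z - eul U c s' x) + (eul U c s' x - eul U c s' y)
   + (eul U c s' y - prop U c c' y) by rewrite !subrKA.
move=> h3; apply: le_trans (ler_normD _ _) _.
have := ler_normD (prop U a c' z - eul U c s' x) (eul U c s' x - eul U c s' y).
by rewrite (distrC _ (eul U c s' x)); lra.
Qed.

(** Telescoping through hybrids that follow [U] up to some point of the subdivision and [U']
    afterwards. Having both [V] and [V'] in the exponent bounds all hybrids at once; the difference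
    of the controls enters only through [W]. *)
Lemma euler_lipschitz U U' V V' W a c s z :
  dominated_on U a c V -> dominated_on U' a c V' ->
  dominated_on (U \- U') a c W -> partition_of a c s ->
  `|eul U a s z - eul U' a s z| <=
  expR (w * (c - a) + b * (V c - V a) + b * (V' c - V' a)) * (b * (W c - W a)) * `|z|.
Proof.
elim: s a z => [|p s IH] a z dV dV' dW P.
  have /andP[_ /eqP/=<-] := P.
  by rewrite subrr normr0 !subrr !mulr0 mul0r.
have /andP[/= /andP[ap ps] sc] := P.
have Pp : partition_of p c s by rewrite /partition_of ps.
have pc := partition_le Pp; have apW := ltW ap.
have sub f g : dominated_on f a c g -> dominated_on f p c g.
  by move=> h; apply: dominated_on_sub h.
have tau0 : 0 <= p - a by rewrite subr_ge0.
rewrite /euler/=.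
change (`|eul U p s (kick S B z (p - a, U p - U a)) -
  eul U' p s (kick S B z (p - a, U' p - U' a))| <=
  expR (w * (c - a) + b * (V c - V a) + b * (V' c - V' a)) *
  (b * (W c - W a)) * `|z|).
set y := kick S B z _; set y' := kick S B z _.
have -> : eul U p s y - eul U' p s y' =
    (eul U p s y - eul U' p s y) + (eul U' p s y - eul U' p s y').
  by rewrite subrKA.
have yz : `|y| <= expR (w * (p - a) + b * (V p - V a)) * `|z|.
  apply: le_trans (kick_bound qS lB _ _) _ => //=.
  rewrite ler_wpM2r// ler_expR lerD2l ler_wpM2l//; exact: dV.
have yy : `|y - y'| <= expR (w * (p - a)) * (b * (W p - W a)) * `|z|.
  have -> : y - y' = S (p - a) ((U p - U' p - (U a - U' a)) *: B z).
    rewrite /y /y' /kick/= -(linB (qc_linear qS tau0)) opprD addrACA subrr add0r.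
    by congr (S _ _); rewrite -scalerBl; congr (_ *: _); ring.
  apply: le_trans (qc_bound qS _ tau0) _; rewrite -!mulrA ler_wpM2l ?expR_ge0//.
  rewrite normrZ mulrCA; apply: ler_pM => //; last exact: lb_bound.
  exact: dW.
have hV : 0 <= V p - V a by rewrite subr_ge0 (dominated_on_le dV).
have hV' : 0 <= V' p - V' a by rewrite subr_ge0 (dominated_on_le dV').
have hVc : 0 <= V c - V p by rewrite subr_ge0 (dominated_on_le dV).
have hV'c : 0 <= V' c - V' p by rewrite subr_ge0 (dominated_on_le dV').
have hW : 0 <= W p - W a by rewrite subr_ge0 (dominated_on_le dW).
have hWc : 0 <= W c - W p by rewrite subr_ge0 (dominated_on_le dW).
set E := expR (w * (c - a) + _ + _).
apply: le_trans (ler_normD _ _) _.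
have -> : E * (b * (W c - W a)) * `|z| =
   E * (b * (W c - W p)) * `|z| + E * (b * (W p - W a)) * `|z| by ring.
apply: lerD.
  apply: le_trans (IH p y (sub _ _ dV) (sub _ _ dV') (sub _ _ dW) Pp) _.
  set F := expR _.
  apply: (@le_trans _ _ (F * (b * (W c - W p)) *
      (expR (w * (p - a) + b * (V p - V a)) * `|z|))).
    by rewrite ler_wpM2l// mulr_ge0 ?expR_ge0// mulr_ge0.
  have -> : F * (b * (W c - W p)) * (expR (w * (p - a) + b * (V p - V a)) * `|z|)
    = (F * expR (w * (p - a) + b * (V p - V a))) * ((b * (W c - W p)) * `|z|) by ring.
  rewrite -[leRHS]mulrA ler_wpM2r//; first by rewrite !mulr_ge0.
  rewrite -expRD ler_expR.
  have : 0 <= b * (V' p - V' a) by rewrite mulr_ge0.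
  lra.
rewrite -(linB (euler_linear qS lB U' Pp)).
apply: le_trans (euler_bound qS lB _ (sub _ _ dV') Pp) _.
set F := expR _.
apply: (@le_trans _ _ (F * (expR (w * (p - a)) * (b * (W p - W a)) * `|z|))).
  by rewrite ler_wpM2l ?expR_ge0.
have -> : F * (expR (w * (p - a)) * (b * (W p - W a)) * `|z|) =
  (F * expR (w * (p - a))) * (b * (W p - W a) * `|z|) by ring.
rewrite -[leRHS]mulrA ler_wpM2r//; first by rewrite !mulr_ge0.
rewrite -expRD ler_expR.
have h1 : 0 <= b * (V' p - V' a) by rewrite mulr_ge0.
have h2 : 0 <= b * (V c - V p) by rewrite mulr_ge0.
have h3 : 0 <= b * (V p - V a) by rewrite mulr_ge0.
lra.
Qed.

Lemma propagate_lipschitz U U' V V' W a c z : a <= c ->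
  dominated_on U a c V -> uniform_on V a c ->
  dominated_on U' a c V' -> uniform_on V' a c ->
  dominated_on (U \- U') a c W ->
  `|prop U a c z - prop U' a c z| <=
  expR (w * (c - a) + b * (V c - V a) + b * (V' c - V' a)) * (b * (W c - W a)) * `|z|.
Proof.
move=> ac dV uV dV' uV' dW; apply/ler_addgt0Pr => e e0.
have [d d0 dP] := propagate_near z ac dV' uV' e0.
apply: (propagate_le ac dV uV d0) => s P ms.
apply: le_trans (ler_distD (eul U' a s z) _ _) _; apply: lerD; last exact: dP.
exact: euler_lipschitz.
Qed.

(** The scheme is invariant under translation in time. Only increments are compared, so [U'] may be
    a primitive on the whole time interval and [U] that of a control restarted at another time. *)
Lemma propagate_shift U V U' a c r z : a <= c -> dominated_on U a c V ->
  uniform_on V a c ->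
  (forall t u, a <= t -> t <= u -> u <= c -> U' (u + r) - U' (t + r) = U u - U t) ->
  prop U' (a + r) (c + r) z = prop U a c z.
Proof.
move=> ac dV uV UU'.
pose V' t := V (t - r).
have dV' : dominated_on U' (a + r) (c + r) V'.
  move=> t u at' tu uc; rewrite /V' -(subrK r t) -(subrK r u) UU'; last 3 first.
  - by rewrite lerBrDr.
  - by rewrite lerD2r.
  - by rewrite lerBlDr.
  by rewrite !addrK; apply: dV; [rewrite lerBrDr|rewrite lerD2r|rewrite lerBlDr].
have uV' : uniform_on V' (a + r) (c + r).
  move=> e /uV[d d0 dP]; exists d => // t u at' tu uc ut; apply: dP.
  - by rewrite lerBrDr.
  - by rewrite lerD2r.
  - by rewrite lerBlDr.
  - by rewrite addrAC lerD2r.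
have acr : a + r <= c + r by rewrite lerD2r.
apply: (propagate_eq acr dV' uV') => e e0.
have [d d0 dP] := propagate_near z ac dV uV e0; exists d => // s P ms.
pose s' := [seq t - r | t <- s].
have P' : partition_of a c s'.
  have /andP[ps /eqP sc] := P; apply/andP; split.
    rewrite /s' -[a](addrK r) (@path_map _ _ (fun t => t - r) _ (a + r)).
    by apply: sub_path ps => t u /=; rewrite ltrD2r.
  by rewrite /s' -[a](addrK r) (last_map (fun t => t - r)) sc addrK.
have ms' : mesh d a s'.
  rewrite /mesh /s' -[a](addrK r) (@path_map _ _ (fun t => t - r) _ (a + r)).
  by apply: sub_path ms => t u /=; rewrite addrAC lerD2r.
suff -> : eul U' (a + r) s z = eul U a s' z by exact: dP.
by rewrite /euler (increments_shift UU').
Qed.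

(** A short interval is a single block, and [d] does not depend on the control. This first-order
    expansion is what identifies generators. *)
Lemma propagate_short z (e : R) : 0 < e -> exists2 d : R, 0 < d &
  forall U V a c, a <= c -> dominated_on U a c V -> uniform_on V a c ->
    c - a <= d -> V c - V a <= d ->
  `|prop U a c z - S (c - a) (z + (U c - U a) *: B z)| <= e * (V c - V a).
Proof.
move=> e0.
have [d d0 dP] := block_error qS lB (totally_bounded1 z) e0.
exists d => // U V a c ac dV uV cd Vd.
apply: (propagate_le ac dV uV ltr01) => s P _.
have /andP[ps /eqP sc] := P.
have := dP (increments U a s) z (forward_increments U ps) erefl.
rewrite dur_increments net_increments sc => H.
have ms := mass_increments dV P.
apply: le_trans (H _ _) _ => //; first exact: le_trans Vd.
by rewrite ler_wpM2l ?(ltW e0).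
Qed.

Lemma propagate_closure U V a c z (T m : R) : a <= c -> dominated_on U a c V ->
  uniform_on V a c -> c - a <= T -> V c - V a <= m ->
  closure (outcomes S B T m [set z]) (prop U a c z).
Proof.
move=> ac dV uV cT Vm N /nbhs_ballP[e /= e0 eN].
have [d d0 dP] := propagate_near z ac dV uV (divr_gt0 e0 (ltr0n _ 2)).
have [s P ms] := partition_exists d0 ac; have /andP[ps /eqP sc] := P.
exists (eul U a s z); split.
  exists (increments U a s), z; split => //; first exact: forward_increments.
    by rewrite dur_increments sc.
  exact: le_trans (mass_increments dV P) Vm.
apply: eN; rewrite -ball_normE /= distrC.
apply: le_lt_trans (dP s P ms) _.
by rewrite ltr_pdivrMr// ltr_pMr// ltr1n.
Qed.

End PropagateTheory.

(** * Generators determine their semigroups *)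

HB.instance Definition _ (V W : puniformType) := Pointed.on (V * W)%type.

(** Makes [Y * R^o] a Banach space, to which the theory of impulses is then applied. *)
Lemma prod_complete (K : numFieldType) (V W : completeNormedModType K)
    (F : set_system (V * W)) : ProperFilter F -> cauchy F -> cvg F.
Proof.
move=> pF cF.
have c1 : cvg (fst @ F).
  apply: cauchy_cvg; apply: cauchy_exP => e e0.
  move: cF => /cauchyP/(_ _ e0)[[x y] xyF].
  exists x; have : F [set p | ball x e p.1]; last by [].
  by apply: filterS xyF => p [].
have c2 : cvg (snd @ F).
  apply: cauchy_cvg; apply: cauchy_exP => e e0.
  move: cF => /cauchyP/(_ _ e0)[[x y] xyF].
  exists y; have : F [set p | ball y e p.2]; last by [].
  by apply: filterS xyF => p [].
apply/cvg_ex; exists (lim (fst @ F), lim (snd @ F)).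
move=> A /(cvg_pair c1 c2) FA; have : F [set p | A (p.1, p.2)] by [].
by apply: filterS => -[].
Qed.

HB.instance Definition _ (K : numFieldType) (V W : completeNormedModType K) :=
  Uniform_isComplete.Build (V * W)%type (@prod_complete K V W).

(** * Density of the domain of the generator *)

Section Density.
Context (R : realType) (Y : completeNormedModType R).
Context (S : R -> Y -> Y) (w : R) (qS : quasi_contractive S w) (x : Y).

Local Notation YR := (Y * R^o)%type.

(* The propagator of this system under the control 1 computes the integral of
   [S s x]: it sends [(0, 1)] to the pair of [\int_0^t S s x ds] and [1]. *)
Let SR (t : R) (p : YR) : YR := (S t p.1, p.2).
Let BR (p : YR) : YR := (p.2 *: x, 0).

Let norm_pair (p : YR) : `|p| = Num.max `|p.1| `|p.2|. Proof. by []. Qed.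

Let qSR : quasi_contractive SR w.
Proof.
have w0 := qc_ge0 qS.
split => //.
- by move=> t t0 k [y c] [y' c'] /=; rewrite /SR /= (qc_linear qS t0).
- by apply/funext => -[y c]; rewrite /SR/= (qc_id qS).
- by move=> s t s0 t0; apply/funext => -[y c]; rewrite /SR/= (qc_add qS).
- move=> t [y c] t0; rewrite !norm_pair /SR/= ge_max; apply/andP; split.
    apply: le_trans (qc_bound qS _ t0) _.
    by rewrite ler_wpM2l ?expR_ge0// le_max lexx.
  apply: (@le_trans _ _ (Num.max `|y| `|c|)); first by rewrite le_max lexx orbT.
  by rewrite ler_peMl ?le_max ?normr_ge0// -expR0 ler_expR mulr_ge0.
- move=> [y c] e e0; have [d d0 dP] := qc_continuous qS y e0.
  exists d => // t td; rewrite norm_pair /SR/= subrr normr0 ge_max dP//=.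
  exact: ltW.
Qed.

Let lBR : lin_bounded BR `|x|.
Proof.
split => //.
- move=> k [y c] [y' c']; rewrite /BR /=; congr pair.
    by rewrite scalerDl -scalerA.
  by rewrite addr0 [RHS]mulr0.
- move=> [y c]; rewrite !norm_pair/= normr0 normrZ mulrC ge_max.
  rewrite mulr_ge0 ?le_max ?normr_ge0// andbT ler_wpM2l//.
  by rewrite le_max lexx orbT.
Qed.

Let P a c := propagate SR BR (@idfun R) a c.

Let dV a c : dominated_on (@idfun R) a c (@idfun R).
Proof. by move=> t u _ tu _; rewrite /= ger0_norm// subr_ge0. Qed.

Let uV a c : uniform_on (@idfun R) a c.
Proof. by move=> e e0; exists e => // t u _ _ _ ut; rewrite lerBlDl. Qed.

Let P_linear t : 0 <= t -> linear (P 0 t).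
Proof. by move=> t0; apply: (propagate_linear qSR lBR t0 (@dV _ _) (@uV _ _)). Qed.

Let P_free t (y : Y) : 0 <= t -> P 0 t (y, 0) = (S t y, 0).
Proof.
move=> t0; apply: (propagate_eq qSR lBR t0 (@dV _ _) (@uV _ _)) => e e0.
exists 1 => // s /andP[ps /eqP st] _.
suff -> : euler SR BR idfun 0 s (y, 0 : R^o) = (S t y, 0).
  by rewrite subrr normr0 ltW.
have H l : forward l -> kicks SR BR l (y, 0 : R^o) = (S (dur l) y, 0).
  elim/last_ind: l => [|l [u c] IH]; first by rewrite /dur big_nil (qc_id qS).
  rewrite /forward all_rcons /= => /andP[u0 fl].
  rewrite kicks_rcons IH// /kick /SR /BR /= scale0r scaler0 addr0 dur_rcons/=.
  by rewrite scaler0 addr0 addrC (qc_addE _ qS)// dur_ge0.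
by rewrite /euler H ?forward_increments// dur_increments st subr0.
Qed.

Let P_snd t : 0 <= t -> (P 0 t (0, 1)).2 = 1.
Proof.
move=> t0; apply/eqP; rewrite -subr_eq0 -normr_le0; apply/ler_addgt0Pr => e e0.
rewrite add0r.
have [d d0 dP] := propagate_near qSR lBR (0, 1) t0 (@dV 0 t) (@uV 0 t) e0.
have [s Ps ms] := partition_exists d0 t0.
have H l : (kicks SR BR l (0 : Y, 1 : R^o)).2 = 1.
  elim/last_ind: l => [//|l p IH].
  by rewrite kicks_rcons /kick /SR /BR /= IH scaler0 addr0.
have := dP s Ps ms; rewrite norm_pair ge_max => /andP[_].
by rewrite /= /euler H distrC.
Qed.

Let F t := (P 0 t (0, 1)).1.

Let PF t : 0 <= t -> P 0 t (0, 1) = (F t, 1).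
Proof. by move=> t0; rewrite [LHS]surjective_pairing P_snd. Qed.

(** In the augmented system, after time [t] the flow goes on for time [r]: [S r] acts on what has
    been accumulated, and the second component, still 1, adds [F r]. *)
Let F_add t r : 0 <= t -> 0 <= r -> F (t + r) = S r (F t) + F r.
Proof.
move=> t0 r0; have tr : t <= t + r by rewrite lerDl.
rewrite /F /P (propagate_cocycle qSR lBR _ t0 tr (@dV _ _) (@uV _ _)) -/(P 0 t) PF//.
have := propagate_shift qSR lBR (F t, 1) (U' := idfun) (r := t) r0
  (@dV 0 r) (@uV 0 r).
rewrite add0r addrC => -> => [|u v _ _ _]; last by rewrite /=; ring.
rewrite -/(P 0 r) -/(P 0 t) -/(F r) -/(F t).
have : (F t, 1 : R^o) = 1 *: (F t, 0 : R^o) + (0 : Y, 1 : R^o).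
  by rewrite scale1r; congr pair; rewrite ?addr0 ?add0r.
by move=> {1}->; rewrite (P_linear r0) P_free// scale1r.
Qed.

(** The impulse of a short interval sits at its left end and then flows for time [r]; this is where
    [S r x] comes from. *)
Let F_short (e : R) : 0 < e ->
  exists2 d : R, 0 < d & forall r, 0 <= r <= d -> `|F r - r *: S r x| <= e * r.
Proof.
move=> e0.
have [d d0 dP] := propagate_short qSR lBR (0, 1) e0.
exists d => // r /andP[r0 rd].
have := dP idfun idfun 0 r r0 (@dV _ _) (@uV _ _).
rewrite subr0 => /(_ rd rd); rewrite norm_pair ge_max => /andP[+ _].
by rewrite /= add0r (linZ (qc_linear qS r0)) scale1r.
Qed.

(* F t / t tends to x, and the difference quotients of S at F t converge since
   S r (F t) - F t = S t (F r) - F r. *)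
Lemma generator_domain_dense (e : R) : 0 < e ->
  exists y z : Y, `|x - y| <= e /\
    r^-1 *: (S r y - y) @[r --> 0^'+] --> z.
Proof.
move=> e0.
have [d d0 dP] := F_short (divr_gt0 e0 (ltr0n _ 2)).
have [d' d'0 d'P] := qc_continuous qS x (divr_gt0 e0 (ltr0n _ 2)).
pose t := Num.min d d'.
have t0 : 0 < t by rewrite lt_min d0.
have [td td'] : t <= d /\ t <= d' by split; rewrite /t ge_min lexx ?orbT.
have tW := ltW t0.
exists (t^-1 *: F t), (t^-1 *: (S t x - x)); split.
  have -> : x - t^-1 *: F t = - (t^-1 *: (F t - t *: S t x) + (S t x - x)).
    by rewrite scalerBr scalerA mulVf ?gt_eqF// scale1r subrKA opprB.
  rewrite normrN; apply: le_trans (ler_normD _ _) _; rewrite [e]splitr lerD//.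
    rewrite normrZ gtr0_norm ?invr_gt0// mulrC ler_pdivrMr//.
    by apply: dP; rewrite tW.
  by apply: d'P; rewrite tW.
apply/cvgrPdist_le => eps eps0.
have w0 := qc_ge0 qS.
set C := expR (w * t); have C0 : 0 < C by rewrite expR_gt0.
(* With this choice the final bound [(C + 1) * (2 * eta * r)] equals [eps * t * r]. *)
pose eta := eps * t / (2 * (C + 1)).
have eta0 : 0 < eta by rewrite divr_gt0 ?mulr_gt0// ltr_wpDl// ltW.
have [d1 d10 d1P] := F_short eta0.
have [d2 d20 d2P] := qc_continuous qS x eta0.
near=> r.
have r0 : 0 < r by near: r; exact: nbhs_right_gt.
have rW := ltW r0.
have rd1 : r <= d1 by near: r; exact: nbhs_right_le.
have rd2 : r <= d2 by near: r; exact: nbhs_right_le.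
have Fr : `|F r - r *: x| <= 2 * eta * r.
  have h1 := d1P r (introT andP (conj rW rd1)).
  have h2 : `|r *: S r x - r *: x| <= eta * r.
    rewrite -scalerBr normrZ gtr0_norm// mulrC ler_wpM2r// d2P// rW//.
  have := ler_distD (r *: S r x) (F r) (r *: x).
  lra.
have lSr := qc_linear qS rW; have lSt := qc_linear qS tW.
have key : S r (F t) - F t = S t (F r) - F r.
  have h : S r (F t) + F r = S t (F r) + F t by rewrite -!F_add// addrC.
  by rewrite -[S r _](addrK (F r)) h addrAC addrK.
rewrite (linZ lSr) -scalerBr scalerA mulrC -scalerA key -scalerBr normrZ.
rewrite gtr0_norm ?invr_gt0// mulrC ler_pdivrMr//.
have -> : S t x - x - r^-1 *: (S t (F r) - F r) =
    r^-1 *: ((F r - r *: x) - S t (F r - r *: x)).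
  rewrite (linB lSt) (linZ lSt) !scalerBr !scalerA mulVf ?gt_eqF// !scale1r.
  by rewrite !opprB addrACA [RHS]addrACA [in RHS](addrC (_ *: F r)).
rewrite normrZ gtr0_norm ?invr_gt0// mulrC ler_pdivrMr//.
apply: le_trans (ler_normB _ _) _.
apply: (@le_trans _ _ ((C + 1) * (2 * eta * r))).
  have := qc_bound qS (F r - r *: x) tW; rewrite -/C.
  set q := `|F r - r *: x| in Fr *.
  have : C * q <= C * (2 * eta * r) by rewrite ler_wpM2l// ltW.
  lra.
rewrite /eta le_eqVlt; apply/orP; left; apply/eqP; field.
by rewrite gt_eqF// ltr_wpDl// ltW.
Unshelve. all: by end_near. Qed.

End Density.

Lemma near_right0P (R : realType) (P : set R) :
  (\forall t \near 0^'+, P t) <->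
  exists2 d : R, 0 < d & forall t, 0 < t -> t < d -> P t.
Proof.
split=> [/nbhs_ballP[d /= d0 dP]|[d d0 dP]].
  exists d => // t t0 td; apply: dP => //.
  by rewrite -ball_normE /= sub0r normrN gtr0_norm.
near=> t; apply: dP; first by near: t; exact: nbhs_right_gt.
by near: t; exact: nbhs_right_lt.
Unshelve. all: by end_near. Qed.

Lemma cvg_right0P (R : realType) (V : normedModType R) (f : R -> V) (l : V) :
  f t @[t --> 0^'+] --> l <->
  forall e : R, 0 < e ->
    exists2 d : R, 0 < d & forall t, 0 < t -> t <= d -> `|l - f t| <= e.
Proof.
split=> [/cvgrPdist_le H e /H/near_right0P[d d0 dP]|H].
  exists (d / 2); first by rewrite divr_gt0.
  by move=> t t0 td; apply: dP => //; lra.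
apply/cvgrPdist_le => e /H[d d0 dP]; apply/near_right0P; exists d => // t t0 td.
by apply: dP => //; exact: ltW.
Qed.

(** * Exponential growth bound of a strongly continuous semigroup *)

Section Growth.
Context (R : realType) (Y : completeNormedModType R) (S : R -> Y -> Y).
Context (hS : C0_semigroup idfun S).

Let SD s t x : 0 <= s -> 0 <= t -> S (s + t) x = S s (S t x).
Proof. by case: hS => _ _ H _ s0 t0; rewrite H. Qed.

Let Slin t : 0 <= t -> linear (S t).
Proof. by case: hS => H _ _ _ /H[]. Qed.

Lemma C0_continuous x (e : R) : 0 < e ->
  exists2 d : R, 0 < d & forall t, 0 <= t <= d -> `|S t x - x| <= e.
Proof.
case: hS => _ S0 _ /(_ x)/cvg_right0P H e0; have [d d0 dP] := H e e0.
exists d => // t /andP[]; rewrite le_eqVlt => /orP[/eqP<- _|t0 td].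
  by rewrite S0 subrr normr0 ltW.
by rewrite distrC dP.
Qed.

(** Strong continuity bounds the orbit on some [[0, d]]; then the single bounded operator [S d]
    carries the bound from one multiple of [d] to the next. This is the pointwise bound that the
    Banach-Steinhaus theorem asks for. *)
Let bounded_orbit x : exists M : R, forall t, 0 <= t <= 1 -> `|S t x| <= M.
Proof.
have [d d0 dP] := C0_continuous x ltr01.
have [K0 K0P] : exists K : R, forall y, `|S d y| <= K * `|y|.
  by case: hS => /(_ d (ltW d0))[_ [K KP]] _ _ _; exists K.
suff H n : exists M : R, forall t, 0 <= t <= n.+1%:R * d -> `|S t x| <= M.
  have [M MP] := H (Num.truncn d^-1); exists M => t /andP[t0 t1].
  apply: MP; rewrite t0/=; apply: (le_trans t1).
  have /andP[_ /ltW] : (Num.truncn d^-1)%:R <= d^-1 < (Num.truncn d^-1).+1%:R.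
    by apply: truncn_itv; rewrite invr_ge0 ltW.
  by rewrite -ler_pdivrMr// div1r.
elim: n => [|n [M MP]].
  exists (`|x| + 1) => t; rewrite mul1r => /dP h.
  by have := lerB_dist (S t x) x; lra.
exists (Num.max M (`|K0| * M)) => t /andP[t0 tn].
have [tn'|tn'] := leP t (n.+1%:R * d); first by rewrite le_max MP ?t0.
have dt : d <= t.
  by apply: le_trans (ltW tn'); rewrite ler_peMl ?(ltW d0)// ler1n.
rewrite -(subrKC d t) SD ?subr_ge0 ?(ltW d0)// le_max; apply/orP; right.
apply: le_trans (K0P _) _; apply: (@le_trans _ _ (`|K0| * `|S (t - d) x|)).
  by rewrite ler_wpM2r// ler_norm.
rewrite ler_wpM2l// MP// subr_ge0 dt/=.
by move: tn; rewrite -[in X in X -> _]natr1 mulrDl mul1r lerBlDr.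
Qed.

(** Uniform boundedness gives a constant [C] on [[0, 1]], and each further unit of time costs a
    factor [C = expR (ln C)], hence [w = ln C]. Taking [C >= 1] makes [w] nonnegative. *)
Lemma C0_growth : exists M w : R, [/\ 1 <= M, 0 <= w &
  forall t x, 0 <= t -> `|S t x| <= M * expR (w * t) * `|x|].
Proof.
have : uniform_bounded [set S t | t in [set t | 0 <= t <= 1]].
  apply: Banach_Steinhauss => [_ [t /andP[t0 _] <-]|x].
    split; last exact: Slin.
    case: hS => /(_ t t0)[_ [K KP]] _ _ _ r; exists (`|K| * r) => y yr.
    apply: le_trans (KP y) _; apply: (@le_trans _ _ (`|K| * `|y|)).
      by rewrite ler_wpM2r// ler_norm.
    by rewrite ler_wpM2l.
  by have [M MP] := bounded_orbit x; exists M => _ [t t01 <-]; exact: MP.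
move=> /(_ 1)[C0 C0P]; pose C := Num.max 1 C0.
have C1 : 1 <= C by rewrite le_max lexx.
have CP t x : 0 <= t <= 1 -> `|S t x| <= C * `|x|.
  move=> t01; have /andP[t0 _] := t01.
  have [->|x0] := eqVneq x 0; first by rewrite (lin0 (Slin t0)) !normr0 mulr0.
  have nx : 0 < `|x| by rewrite normr_gt0.
  have : `|S t (`|x|^-1 *: x)| <= C0.
    apply: C0P; first by exists t.
    by rewrite normrZ gtr0_norm ?invr_gt0// mulVf// gt_eqF.
  rewrite (linZ (Slin t0)) normrZ gtr0_norm ?invr_gt0// mulrC ler_pdivrMr//.
  by move=> /le_trans; apply; rewrite ler_wpM2r// le_max lexx orbT.
have C_gt0 : 0 < C by exact: lt_le_trans C1.
exists C, (ln C); split => //; first by rewrite ln_ge0.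
move=> t x t0; have [n tn] : exists n : nat, t <= n.+1%:R.
  by exists (Num.truncn t); have /andP[_ /ltW] := truncn_itv t0.
elim: n t t0 tn => [|n IH] t t0 tn.
  apply: le_trans (CP t x _) _; first by rewrite t0.
  rewrite ler_wpM2r// ler_peMr ?(ltW C_gt0)// -expR0 ler_expR mulr_ge0//.
  by rewrite ln_ge0.
have [t1|t1] := leP t 1.
  apply: le_trans (CP t x _) _; first by rewrite t0.
  rewrite ler_wpM2r// ler_peMr ?(ltW C_gt0)// -expR0 ler_expR mulr_ge0//.
  by rewrite ln_ge0.
have t10 : 0 <= t - 1 by rewrite subr_ge0 ltW.
rewrite -{1}(subrKC 1 t) SD//; apply: le_trans (CP _ _ _) _; first by rewrite lexx ler01.
have {}IH : `|S (t - 1) x| <= C * expR (ln C * (t - 1)) * `|x|.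
  by apply: IH => //; rewrite lerBlDr natr1.
have -> : expR (ln C * t) = C * expR (ln C * (t - 1)).
  by rewrite mulrBr mulr1 expRB lnK ?posrE// mulrCA divff ?mulr1// gt_eqF.
by rewrite -!mulrA ler_pM2l// mulrA.
Qed.

End Growth.

(** Consider the supremum of the times up to which [g] departs from [g 0] with slope at most [e].
    Left continuity preserves the bound at the supremum, and the right derivative pushes it further
    as long as [T] is not reached. *)
Lemma zero_right_derivative (R : realType) (Y : completeNormedModType R)
    (g : R -> Y) (T : R) : 0 <= T ->
  (forall s (e : R), 0 < s -> s <= T -> 0 < e -> exists2 d : R, 0 < d &
     forall h, 0 <= h -> h <= d -> h <= s -> `|g s - g (s - h)| <= e) ->
  (forall s (e : R), 0 <= s -> s < T -> 0 < e -> exists2 d : R, 0 < d &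
     forall h, 0 < h -> h <= d -> s + h <= T -> `|g (s + h) - g s| <= e * h) ->
  g T = g 0.
Proof.
move=> T0 lc rd; apply/eqP; rewrite -subr_eq0 -normr_le0.
apply/ler_addgt0Pr => e' e'0; rewrite add0r.
have T1 : 0 < T + 1 by rewrite ltr_wpDl.
pose e := e' / (T + 1); have e0 : 0 < e by rewrite divr_gt0.
pose E := [set s : R | 0 <= s <= T /\
  forall r, 0 <= r -> r <= s -> `|g r - g 0| <= e * r].
have E0 : E 0.
  split; first by rewrite lexx.
  move=> r r0 r0'; have -> : r = 0 by apply/le_anti; rewrite r0' r0.
  by rewrite subrr normr0 mulr0.
have bE : has_ubound E by exists T => s [/andP[]].
pose s := sup E.
have s0 : 0 <= s by exact: ub_le_sup.
have sT : s <= T by apply: ge_sup; [exists 0|move=> t [/andP[]]].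
have below r : 0 <= r -> r < s -> `|g r - g 0| <= e * r.
  move=> r0 rs; have [||t [_ tP] rt] := @sup_adherent _ E (s - r).
  - by rewrite subr_gt0.
  - by split; [exists 0|].
  by apply: tP => //; move: rt; rewrite -/s opprB subrKC => /ltW.
have at_s : `|g s - g 0| <= e * s.
  have [s_gt0|] := ltP 0 s; last first.
    move=> s0'; have -> : s = 0 by apply/le_anti; rewrite s0' s0.
    by case: E0 => _; apply.
  apply/ler_addgt0Pr => eps eps0; have [d d0 dP] := lc s eps s_gt0 sT eps0.
  pose h := Num.min d s; have h0 : 0 < h by rewrite lt_min d0.
  have hs : h <= s by rewrite ge_min lexx orbT.
  have h1 : `|g s - g (s - h)| <= eps by apply: dP; rewrite ?(ltW h0)// ge_min lexx.
  have h2 : `|g (s - h) - g 0| <= e * (s - h).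
    by apply: below; rewrite ?subr_ge0// ltrBlDr ltrDl.
  have := ler_distD (g (s - h)) (g s) (g 0).
  have : 0 <= e * h by rewrite mulr_ge0// ltW.
  lra.
have [sltT|Tles] := ltP s T; last first.
  have -> : T = s by apply/le_anti; rewrite Tles sT.
  apply: le_trans at_s _; rewrite /e mulrAC ler_pdivrMr// ler_wpM2l ?(ltW e'0)//.
  lra.
have [d d0 dP] := rd s e s0 sltT e0.
pose h := Num.min d (T - s); have h0 : 0 < h by rewrite lt_min d0 subr_gt0.
have [hd hT] : h <= d /\ h <= T - s by split; rewrite ge_min lexx ?orbT.
have : E (s + h).
  split; first by rewrite addr_ge0 ?(ltW h0)//=; lra.
  move=> r r0 rsh; have [rs|sr] := ltP r s; first exact: below.
  have [->//|rs] := eqVneq r s.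
  have rs0 : 0 < r - s by rewrite subr_gt0 lt_neqAle eq_sym rs.
  have := dP (r - s) rs0; rewrite subrKC => /(_ _ _) H.
  have {}H : `|g r - g s| <= e * (r - s) by apply: H; lra.
  have := ler_distD (g s) (g r) (g 0).
  lra.
by move=> /(ub_le_sup bE); rewrite -/s; lra.
Qed.

(** For [x] in the domain of the generator, [s |-> S2 (T - s) (S1 s x)] joins [S2 T x] to [S1 T x]
    and has zero right derivative. Density of the domain and boundedness of both operators extend
    the equality to all vectors. *)
Lemma semigroup_unique (R : realType) (Y : completeNormedModType R)
    (S1 S2 : R -> Y -> Y) (w : R) :
  quasi_contractive S1 w -> C0_semigroup idfun S2 ->
  (forall x z : Y, r^-1 *: (S1 r x - x) @[r --> 0^'+] --> z ->
     r^-1 *: (S2 r x - x) @[r --> 0^'+] --> z) ->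
  forall T, 0 <= T -> S1 T = S2 T.
Proof.
move=> q1 c2 gen T T0; apply/funext => x0.
have [M [w2 [M1 w20 MP]]] := C0_growth c2.
pose C := M * expR (w2 * T).
have C0 : 0 < C by rewrite mulr_gt0 ?expR_gt0//; exact: lt_le_trans M1.
have CP t x : 0 <= t -> t <= T -> `|S2 t x| <= C * `|x|.
  move=> t0 tT; apply: le_trans (MP t x t0) _; rewrite ler_wpM2r// ler_pM2l.
    by rewrite ler_expR ler_wpM2l.
  exact: lt_le_trans M1.
have lin2 t : 0 <= t -> linear (S2 t) by case: c2 => H _ _ _ /H[].
have add2 s t x : 0 <= s -> 0 <= t -> S2 (s + t) x = S2 s (S2 t x).
  by case: c2 => _ _ H _ s0 t0; rewrite H.
have dom (x z : Y) : r^-1 *: (S1 r x - x) @[r --> 0^'+] --> z -> S1 T x = S2 T x.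
  move=> xz; pose g s := S2 (T - s) (S1 s x).
  have <- : g T = S1 T x by rewrite /g subrr; case: c2 => _ ->.
  have -> : S2 T x = g 0 by rewrite /g subr0 (qc_id q1).
  apply: zero_right_derivative => //.
    move=> s e s_gt0 sT e0.
    (* One [eta] for the move of [S1 s x] under [S2 h] and one for that of [x] under [S1 h], each
       amplified by the operators applied afterwards; together they give [e]. *)
    pose eta := e / (C * (1 + C * expR (w * T))).
    have K0 : 0 < C * expR (w * T) by rewrite mulr_gt0 ?expR_gt0.
    have eta0 : 0 < eta by apply: divr_gt0 => //; apply: mulr_gt0 => //; exact: addr_gt0.
    have [d1 d10 d1P] := C0_continuous c2 (S1 s x) eta0.
    have [d2 d20 d2P] := qc_continuous q1 x eta0.
    exists (Num.min d1 d2); first by rewrite lt_min d10.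
    move=> h h0; rewrite le_min => /andP[hd1 hd2] hs.
    have Ts : 0 <= T - s by rewrite subr_ge0.
    have sh : 0 <= s - h by rewrite subr_ge0.
    have -> : g s - g (s - h) = S2 (T - s) ((S1 s x - S2 h (S1 s x)) +
        S2 h (S1 s x - S1 (s - h) x)).
      rewrite /g (_ : T - (s - h) = (T - s) + h); last by ring.
      by rewrite (add2 (T - s) h)// -(linB (lin2 _ Ts)) (linB (lin2 _ h0)) subrKA.
    apply: le_trans (CP _ _ Ts _) _; first by lra.
    have h1 : `|S1 s x - S2 h (S1 s x)| <= eta by rewrite distrC d1P// h0.
    have h2 : `|S1 s x - S1 (s - h) x| <= expR (w * T) * eta.
      rewrite -{1}(subrK h s) (qc_addE _ q1)// -(linB (qc_linear q1 sh)).
      have shT : s - h <= T by lra.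
      apply: le_trans (qc_boundW q1 _ sh shT) _.
      by rewrite ler_wpM2l ?expR_ge0// d2P ?h0.
    have h3 : `|S2 h (S1 s x - S1 (s - h) x)| <= C * (expR (w * T) * eta).
      apply: le_trans (CP _ _ h0 _) _; first by lra.
      by rewrite ler_wpM2l// ltW.
    have -> : e = C * (eta + C * (expR (w * T) * eta)).
      rewrite /eta; field; rewrite !gt_eqF// addr_gt0//.
    rewrite ler_wpM2l ?(ltW C0)//; apply: le_trans (ler_normD _ _) _.
    exact: lerD.
  move=> s e s0 sT e0.
  have Ts : 0 < T - s by rewrite subr_gt0.
  (* The flow preserves its domain because [S1 s] commutes with the difference quotients. *)
  have der1 : r^-1 *: (S1 r (S1 s x) - S1 s x) @[r --> 0^'+] --> S1 s z.
    apply/cvg_right0P => eps eps0.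
    have E0 : 0 < expR (w * s) by rewrite expR_gt0.
    move/cvg_right0P : xz => /(_ _ (divr_gt0 eps0 E0))[d d0 dP].
    exists d => // r r0 rd; have rW := ltW r0; have ls := qc_linear q1 s0.
    rewrite -(qc_addE _ q1)// [r + s]addrC (qc_addE _ q1)//.
    rewrite -(linB ls) -(linZ ls) -(linB ls).
    apply: le_trans (qc_bound q1 _ s0) _.
    by rewrite mulrC -ler_pdivlMr// dP.
  have der2 := gen _ _ der1.
  have eC0 : 0 < e / C / 2 by rewrite !divr_gt0.
  move/cvg_right0P : der1 => /(_ _ eC0)[d1 d10 d1P].
  move/cvg_right0P : der2 => /(_ _ eC0)[d2 d20 d2P].
  exists (Num.min d1 d2); first by rewrite lt_min d10.
  move=> h h0; rewrite le_min => /andP[hd1 hd2] shT.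
  have Tsh : 0 <= T - (s + h) by rewrite subr_ge0.
  have hW := ltW h0.
  have -> : g (s + h) - g s = S2 (T - (s + h)) (S1 h (S1 s x) - S2 h (S1 s x)).
    rewrite /g (_ : T - s = T - (s + h) + h); last by ring.
    rewrite (add2 (T - (s + h)) h)// [in S1 _ _]addrC (qc_addE _ q1)//.
    by rewrite (linB (lin2 _ Tsh)).
  apply: le_trans (CP _ _ Tsh _) _; first by lra.
  rewrite mulrC -ler_pdivlMr// -mulrAC -ler_pdivrMr// mulrC.
  rewrite -[h^-1]gtr0_norm ?invr_gt0// -normrZ.
  have -> : h^-1 *: (S1 h (S1 s x) - S2 h (S1 s x)) =
     (h^-1 *: (S1 h (S1 s x) - S1 s x) - S1 s z) +
     (S1 s z - h^-1 *: (S2 h (S1 s x) - S1 s x)).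
    by rewrite subrKA -scalerBr opprB addrA subrK.
  apply: le_trans (ler_normD _ _) _; rewrite [e / C]splitr; apply: lerD.
    by rewrite distrC d1P.
  exact: d2P.
apply/eqP; rewrite -subr_eq0 -normr_le0; apply/ler_addgt0Pr => e e0.
rewrite add0r.
pose K := expR (w * T) + C; have K0 : 0 < K by rewrite addr_gt0 ?expR_gt0.
have [y [z [xy yz]]] := generator_domain_dense q1 x0 (divr_gt0 e0 K0).
have -> : S1 T x0 - S2 T x0 = S1 T (x0 - y) - S2 T (x0 - y).
  rewrite (linB (qc_linear q1 T0)) (linB (lin2 _ T0)) (dom _ _ yz).
  by rewrite opprB addrA subrK.
apply: le_trans (ler_normB _ _) _.
have := qc_bound q1 (x0 - y) T0; have := CP T (x0 - y) T0 (lexx _).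
have : K * `|x0 - y| <= e by rewrite mulrC -ler_pdivlMr.
rewrite /K; lra.
Qed.

(** * Renorming by a real norm *)

Section ScalarField.
Context (R : realType) (K : numFieldType) (iota : R -> K).
Context (hK : real_or_complex iota).

Lemma iota_add x y : iota (x + y) = iota x + iota y.
Proof. by case: hK => //; exact: rmorphD. Qed.

Lemma iota_mul x y : iota (x * y) = iota x * iota y.
Proof. by case: hK => //; exact: rmorphM. Qed.

Lemma iota_one : iota 1 = 1.
Proof. by case: hK => //; exact: rmorph1. Qed.

Lemma le_iota x y : (iota x <= iota y) = (x <= y).
Proof. by case: hK => //; exact: lecR. Qed.

Lemma iota_nneg_surj k : 0 <= k -> exists r, iota r = k.
Proof.
case: hK k => [k _|[a b]]; first by exists k.
by rewrite lecE /= => /andP[/eqP-> _]; exists a.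
Qed.

Lemma iota_norm x : `|iota x| = iota `|x|.
Proof.
case: hK => //; rewrite normc_def /= expr0n addr0 sqrtr_sqr //.
Qed.

Lemma iota_zero : iota 0 = 0.
Proof. by apply: (addrI (iota 0)); rewrite -iota_add !addr0. Qed.

Lemma lt_iota x y : (iota x < iota y) = (x < y).
Proof. by rewrite !lt_neqAle le_iota !eq_le !le_iota. Qed.

Lemma iota_gt0 x : (0 < iota x) = (0 < x).
Proof. by rewrite -iota_zero lt_iota. Qed.

End ScalarField.

Section RealNorm.
Context (R : realType) (K : numFieldType) (iota : R -> K).
Context (hK : real_or_complex iota) (X : completeNormedModType K).

(* The norm of X takes its values in K; this is the corresponding real. *)
Definition rnorm (x : X) : R := xget 0 [set r | iota r = `|x|].

Lemma rnormE x : iota (rnorm x) = `|x|.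
Proof.
rewrite /rnorm; case: xgetP => [r _ //|]; have [r rx] := iota_nneg_surj hK (normr_ge0 x).
by move=> /(_ r) /(_ rx).
Qed.

(** [N] is a norm over R also when [K] is complex, since trajectories are studied over R in both
    cases. *)
Record equivalent_norm (N : X -> R) : Prop := EquivalentNorm {
  en_add : forall x y, N (x + y) <= N x + N y;
  en_scale : forall c x, N (iota c *: x) = `|c| * N x;
  en_ge : forall x, rnorm x <= N x;
  en_le : exists M, forall x, N x <= M * rnorm x }.

Lemma rnorm_equivalent : equivalent_norm rnorm.
Proof.
split => [x y|c x|x//|].
- by rewrite -(le_iota hK) (iota_add hK) !rnormE ler_normD.
- apply/le_anti; rewrite -!(le_iota hK) (iota_mul hK) !rnormE -(iota_norm hK).
  by rewrite normrZ lexx.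
- by exists 1 => x; rewrite mul1r.
Qed.

End RealNorm.

(* The type X itself, with scalars restricted to R along iota and the norm N. *)
Definition renormed (R : realType) (K : numFieldType) (iota : R -> K)
  (hK : real_or_complex iota) (X : completeNormedModType K) (N : X -> R)
  (eN : equivalent_norm iota N) : Type := X.

Section Renormed.
Context (R : realType) (K : numFieldType) (iota : R -> K).
Context (hK : real_or_complex iota) (X : completeNormedModType K) (N : X -> R).
Context (eN : equivalent_norm iota N).
Local Notation Y := (renormed hK eN).

HB.instance Definition _ := GRing.Zmodule.copy Y X.

Definition renormed_scale (c : R) (x : Y) : Y := (iota c *: (x : X)).

Let scaleA a b (v : Y) :
  renormed_scale a (renormed_scale b v) = renormed_scale (a * b) v.
Proof. by rewrite /renormed_scale (iota_mul hK) scalerA. Qed.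

Let scale1 : left_id 1 renormed_scale.
Proof. by move=> v; rewrite /renormed_scale (iota_one hK) scale1r. Qed.

Let scaleDr : right_distributive renormed_scale +%R.
Proof. by move=> a u v; rewrite /renormed_scale scalerDr. Qed.

Let scaleDl v : {morph renormed_scale^~ v : a b / a + b}.
Proof. by move=> a b; rewrite /renormed_scale (iota_add hK) scalerDl. Qed.

HB.instance Definition _ :=
  GRing.Zmodule_isLmodule.Build R Y scaleA scale1 scaleDr scaleDl.

Let norm_eq0 (x : Y) : N x = 0 -> x = 0.
Proof.
move=> x0; have := en_ge eN x; rewrite x0 -(le_iota hK) (rnormE hK) (iota_zero hK).
by rewrite normr_le0 => /eqP.
Qed.

HB.instance Definition _ := Lmodule_isNormed.Build R Y
  (en_add eN) (en_scale eN) norm_eq0.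

Lemma rnorm_le (x : X) (c : R) : (`|x| <= iota c) = (rnorm iota x <= c).
Proof. by rewrite -(le_iota hK) (rnormE hK). Qed.

(** Both norms define the same topology; strong continuity, generators and completeness are all
    transferred through this equivalence. *)
Lemma renormed_cvg (T : Type) (F : set_system T) (f : T -> X) (l : X) : Filter F ->
  f t @[t --> F] --> l <-> (f t : Y) @[t --> F] --> (l : Y).
Proof.
move=> FF; have [M MP] := en_le eN.
split => [/cvgrPdist_le H|/cvgrPdist_le H]; apply/cvgrPdist_le => e e0.
  have M0 : 0 < `|M| + 1 by rewrite ltr_wpDl.
  have : 0 < iota (e / (`|M| + 1)) by rewrite (iota_gt0 hK) divr_gt0.
  move=> /H; apply: filterS => t; rewrite rnorm_le => h.
  apply: le_trans (MP _) _; apply: (@le_trans _ _ ((`|M| + 1) * rnorm iota (l - f t))).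
    rewrite ler_wpM2r//; last by have := ler_norm M; lra.
    by rewrite -(le_iota hK) (iota_zero hK) (rnormE hK).
  by rewrite mulrC -ler_pdivlMr.
have [r re] := iota_nneg_surj hK (ltW e0); move: e0; rewrite -re (iota_gt0 hK).
move=> /H; apply: filterS => t h; rewrite rnorm_le.
exact: le_trans (en_ge eN _) h.
Qed.

Let renormed_complete (F : set_system Y) : ProperFilter F -> cauchy F -> cvg F.
Proof.
move=> pF cF.
have cX : cauchy (F : set_system X).
  apply: cauchy_exP => e e0.
  have [r re] := iota_nneg_surj hK (ltW e0); move: e0; rewrite -re (iota_gt0 hK) => r0.
  move: cF => /cauchyP/(_ _ r0)[x xF]; exists x.
  apply: filterS xF => y; rewrite -!ball_normE /= => h.
  rewrite -(rnormE hK) (lt_iota hK); exact: le_lt_trans (en_ge eN _) h.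
have /(renormed_cvg id (lim (F : set_system X)) pF) h : cvg (F : set_system X).
  exact: cauchy_cvg.
by apply/cvg_ex; exists (lim (F : set_system X)).
Qed.

HB.instance Definition _ := Uniform_isComplete.Build Y renormed_complete.

End Renormed.

(** * An equivalent norm in which the semigroup is quasi-contractive *)

Section GrowthNorm.
Context (R : realType) (Y : completeNormedModType R) (S : R -> Y -> Y).
Context (hS : C0_semigroup idfun S) (M w : R) (w0 : 0 <= w).
Context (growth : forall t x, 0 <= t -> `|S t x| <= M * expR (w * t) * `|x|).

Let values x := [set expR (- (w * t)) * `|S t x| | t in [set t : R | 0 <= t]].

(* In this norm products of many propagators do not accumulate powers of M. *)
Definition growth_norm x : R := sup (values x).

Let values_neq0 x : values x !=set0.
Proof. by exists (expR (- (w * 0)) * `|S 0 x|), 0 => /=. Qed.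

Let values_ub x : ubound (values x) (M * `|x|).
Proof.
move=> _ [t /= t0 <-]; rewrite expRN -ler_pdivlMl ?invr_gt0 ?expR_gt0//.
by rewrite invrK mulrA [_ * M]mulrC growth.
Qed.

Let le_growth_norm t x : 0 <= t -> expR (- (w * t)) * `|S t x| <= growth_norm x.
Proof.
move=> t0; apply: ub_le_sup; last by exists t.
by exists (M * `|x|); exact: values_ub.
Qed.

Lemma growth_norm_ge x : `|x| <= growth_norm x.
Proof.
have := @le_growth_norm 0 x (lexx _); rewrite mulr0 oppr0 expR0 mul1r.
by case: hS => _ ->.
Qed.

Lemma growth_norm_le x : growth_norm x <= M * `|x|.
Proof. by apply: ge_sup => //; exact: values_ub. Qed.

Let lS t : 0 <= t -> linear (S t).
Proof. by case: hS => H _ _ _ /H[]. Qed.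

Lemma growth_normD x y : growth_norm (x + y) <= growth_norm x + growth_norm y.
Proof.
apply: ge_sup => // _ [t /= t0 <-]; rewrite (linD (lS t0)).
apply: (@le_trans _ _ (expR (- (w * t)) * (`|S t x| + `|S t y|))).
  by rewrite ler_wpM2l ?expR_ge0// ler_normD.
by rewrite mulrDr; apply: lerD; exact: le_growth_norm.
Qed.

Lemma growth_normZ c x : growth_norm (c *: x) = `|c| * growth_norm x.
Proof.
have H d y : growth_norm (d *: y) <= `|d| * growth_norm y.
  apply: ge_sup => // _ [t /= t0 <-]; rewrite (linZ (lS t0)) normrZ mulrCA.
  by rewrite ler_wpM2l//; exact: le_growth_norm.
apply/le_anti; rewrite H/=.
have [->|c0] := eqVneq c 0.
  by rewrite normr0 mul0r (le_trans _ (growth_norm_ge _)).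
have nc : 0 < `|c| by rewrite normr_gt0.
have := H c^-1 (c *: x); rewrite scalerA mulVf// scale1r normfV.
by rewrite mulrC ler_pdivlMr// mulrC.
Qed.

(** The supremum on the left runs over the times [s + t] with [s >= 0], a part of those on the
    right; changing the weight costs [expR (w * t)]. *)
Lemma growth_norm_semigroup t x : 0 <= t ->
  growth_norm (S t x) <= expR (w * t) * growth_norm x.
Proof.
move=> t0; apply: ge_sup => // _ [s /= s0 <-].
have -> : S s (S t x) = S (s + t) x by case: hS => _ _ H _; rewrite H.
have -> : expR (- (w * s)) = expR (w * t) * expR (- (w * (s + t))).
  by rewrite -expRD; congr expR; ring.
by rewrite -mulrA ler_wpM2l ?expR_ge0// le_growth_norm// addr_ge0.
Qed.

End GrowthNorm.

Section Transfer.
Context (R : realType) (K : numFieldType) (iota : R -> K).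
Context (hK : real_or_complex iota) (X : completeNormedModType K) (N : X -> R).
Context (eN : equivalent_norm iota N).
Local Notation Y := (renormed hK eN).

Lemma renormed_linear (F : X -> X) : linear F -> linear (F : Y -> Y).
Proof. by move=> lF a x y; exact: lF. Qed.

Lemma renormed_const : exists2 M : R, 0 < M &
  forall x : X, N x <= M * rnorm iota x.
Proof.
have [M MP] := en_le eN; exists (`|M| + 1); first by rewrite ltr_wpDl.
move=> x; apply: le_trans (MP x) _; rewrite ler_wpM2r//.
  by rewrite -(le_iota hK) (iota_zero hK) (rnormE hK).
by have := ler_norm M; lra.
Qed.

Lemma renormed_bounded (F : X -> X) : bounded_operator iota F ->
  exists2 k : R, 0 <= k & forall x : Y, `|(F x : Y)| <= k * `|x|.
Proof.
move=> [_ [c cP]]; have [M M0 MP] := renormed_const.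
exists (M * `|c|); first by rewrite mulr_ge0 ?(ltW M0).
move=> x; apply: le_trans (MP _) _; rewrite -mulrA ler_wpM2l ?(ltW M0)//.
apply: (@le_trans _ _ (`|c| * rnorm iota x)).
  have := cP x; rewrite -!(rnormE hK) -(iota_mul hK) (le_iota hK) => /le_trans; apply.
  rewrite ler_wpM2r ?ler_norm// -(le_iota hK) (iota_zero hK) (rnormE hK) //.
by rewrite ler_wpM2l//; exact: (en_ge eN).
Qed.

Lemma renormed_lin_bounded (F : X -> X) : bounded_operator iota F ->
  exists b, lin_bounded (F : Y -> Y) b.
Proof.
move=> bF; have [k k0 kP] := renormed_bounded bF; exists k; split => //.
by case: bF => lF _; exact: renormed_linear.
Qed.

Lemma renormed_C0 (S : R -> X -> X) : C0_semigroup iota S ->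
  C0_semigroup (idfun : R -> R) (S : R -> Y -> Y).
Proof.
case=> bS S0 SD Sc; split => //.
  move=> t t0; have [k k0 kP] := renormed_bounded (bS t t0).
  by split; [case: (bS t t0) => lS _; exact: renormed_linear|exists k].
by move=> x; apply/(renormed_cvg hK eN); exact: Sc.
Qed.

Lemma opnorm_lt (M c eps : R) (F : X -> X) : 0 < M -> 0 <= c ->
  (forall x : X, N x <= M * rnorm iota x) ->
  (forall x : X, N (F x) <= c * N x) -> c * M < eps ->
  opnorm iota F < eps.
Proof.
move=> M0 c0 MP cP; apply: le_lt_trans; apply: ge_inf.
  by exists 0 => ? [].
split; first by rewrite mulr_ge0 ?(ltW M0).
move=> x; rewrite -!(rnormE hK) -(iota_mul hK) (le_iota hK).
apply: le_trans (en_ge eN _) _; apply: le_trans (cP _) _.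
by rewrite -mulrA ler_wpM2l.
Qed.

Lemma bounded_operator_renormed (c : R) (F : X -> X) : linear F -> 0 <= c ->
  (forall x : X, N (F x) <= c * N x) -> bounded_operator iota F.
Proof.
move=> lF c0 cP; split => //; have [M M0 MP] := renormed_const; exists (c * M).
move=> x; rewrite -!(rnormE hK) -(iota_mul hK) (le_iota hK).
apply: le_trans (en_ge eN _) _; apply: le_trans (cP _) _.
by rewrite -mulrA ler_wpM2l.
Qed.

End Transfer.

(** Two renormings: the growth bound is obtained in the real space carrying the original norm, and
    the supremum norm built from this bound is then taken as [N]. *)
Lemma quasi_contractive_renorm (R : realType) (K : numFieldType) (iota : R -> K)
    (hK : real_or_complex iota) (X : completeNormedModType K) (S : R -> X -> X) :
  C0_semigroup iota S -> exists N (eN : equivalent_norm iota N) w,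
    quasi_contractive (S : R -> renormed hK eN -> renormed hK eN) w.
Proof.
move=> cS; pose Y0 := renormed hK (rnorm_equivalent hK X).
have cS0 := renormed_C0 hK (rnorm_equivalent hK X) cS.
have [M [w [M1 w0 MP]]] := C0_growth cS0.
pose N := growth_norm (S : R -> Y0 -> Y0) w.
have eN : equivalent_norm iota N.
  split.
  - exact: (growth_normD cS0 MP).
  - exact: (growth_normZ cS0 MP).
  - exact: (growth_norm_ge cS0 MP).
  - by exists M; exact: (growth_norm_le MP).
exists N, eN, w.
have cSN := renormed_C0 hK eN cS.
split => //.
- by move=> t t0; case: cSN => /(_ t t0)[].
- by case: cSN.
- by case: cSN.
- by move=> t x t0; exact: (growth_norm_semigroup cS0 MP).
- by move=> x e e0; exact: (C0_continuous cSN).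
Qed.

(** * Perturbed semigroups *)

Section LinearControl.
Context (R : realType) (Y : completeNormedModType R).
Context (S : R -> Y -> Y) (w : R) (qS : quasi_contractive S w).
Context (B : Y -> Y) (b : R) (lB : lin_bounded B b) (v : R).

(** The control constantly equal to [v] has primitive [t |-> v t]; the semigroup of [A + v B] is
    thus produced by the impulse scheme itself rather than by a perturbation series. *)
Definition perturbed (t : R) : Y -> Y := propagate S B ( *%R v) 0 t.

Lemma linear_dominated a c : dominated_on ( *%R v) a c ( *%R `|v|).
Proof. by move=> t u _ tu _; rewrite -!mulrBr normrM [`|u - t|]ger0_norm// subr_ge0. Qed.

Lemma linear_uniform a c : uniform_on ( *%R `|v|) a c.
Proof.
move=> e e0; have v1 : 0 < `|v| + 1 by rewrite ltr_wpDl.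
exists (e / (`|v| + 1)); first by rewrite divr_gt0.
move=> t u _ tu _ utd; rewrite -mulrBr.
apply: (@le_trans _ _ ((`|v| + 1) * (u - t))).
  by rewrite ler_wpM2r ?subr_ge0// lerDl.
by rewrite mulrC -ler_pdivlMr// lerBlDl.
Qed.

Lemma perturbed_add s t x : 0 <= s -> 0 <= t ->
  perturbed (s + t) x = perturbed s (perturbed t x).
Proof.
move=> s0 t0; have ts : t <= t + s by rewrite lerDl.
rewrite addrC /perturbed.
rewrite (propagate_cocycle qS lB x t0 ts (@linear_dominated _ _) (@linear_uniform _ _)).
have := propagate_shift qS lB (propagate S B ( *%R v) 0 t x) (U' := *%R v) (r := t)
  s0 (@linear_dominated 0 s) (@linear_uniform 0 s).
by rewrite add0r [s + t]addrC; apply => p q _ _ _; ring.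
Qed.

(** [propagate_short] gives [S t (x + (v * t) *: B x)] up to o(t), and continuity of the flow at
    [B x] removes [S t] from the second term. *)
Lemma perturbed_short x (e : R) : 0 < e ->
  exists2 d : R, 0 < d & forall t, 0 <= t -> t <= d ->
    `|perturbed t x - S t x - (v * t) *: B x| <= e * t.
Proof.
move=> e0.
have v1 : 0 < `|v| + 1 by rewrite ltr_wpDl.
have e1 : 0 < e / (`|v| + 1) / 2 by rewrite !divr_gt0.
have [d1 d10 d1P] := propagate_short qS lB x e1.
have [d2 d20 d2P] := qc_continuous qS (B x) e1.
exists (Num.min (d1 / (`|v| + 1)) d2); first by rewrite lt_min divr_gt0.
move=> t t0; rewrite le_min => /andP[td1 td2].
have td : (`|v| + 1) * t <= d1 by rewrite mulrC -ler_pdivlMr.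
have vt0 : 0 <= `|v| * t by rewrite mulr_ge0.
have h1 : `|perturbed t x - S t (x + (v * t) *: B x)| <= e / (`|v| + 1) / 2 * (`|v| * t).
  have := d1P ( *%R v) ( *%R `|v|) 0 t t0 (@linear_dominated _ _) (@linear_uniform _ _).
  by rewrite !mulr0 !subr0; apply; lra.
have lS := qc_linear qS t0.
have h2 : `|S t (x + (v * t) *: B x) - S t x - (v * t) *: B x| <=
    e / (`|v| + 1) / 2 * (`|v| * t).
  rewrite (linD lS) (linZ lS) [S t x + _]addrC addrK -scalerBr normrZ mulrC.
  rewrite normrM (ger0_norm t0) ler_wpM2r// d2P// t0//.
have -> : perturbed t x - S t x - (v * t) *: B x =
    (perturbed t x - S t (x + (v * t) *: B x)) +
    (S t (x + (v * t) *: B x) - S t x - (v * t) *: B x) by rewrite -!addrA addKr.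
apply: le_trans (ler_normD _ _) _; apply: le_trans (lerD h1 h2) _.
rewrite -mulrDl -splitr mulrA ler_wpM2r// mulrAC ler_pdivrMr//.
by rewrite ler_wpM2l ?(ltW e0)// lerDl.
Qed.

Lemma perturbed_quasi_contractive : quasi_contractive perturbed (w + b * `|v|).
Proof.
have dV := @linear_dominated; have uV := @linear_uniform.
split.
- by rewrite addr_ge0 ?(qc_ge0 qS)// mulr_ge0 ?(lb_ge0 lB).
- by move=> t t0; apply: (propagate_linear qS lB t0 (dV _ _) (uV _ _)).
- exact: (propagate_id qS lB).
- by move=> s t s0 t0; apply/funext => x; rewrite perturbed_add.
- move=> t x t0; apply: le_trans (propagate_bound qS lB x t0 (dV _ _) (uV _ _)) _.
  by rewrite mulr0 !subr0 mulrA -mulrDl.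
- move=> x e e0; have e30 : 0 < e / 3 by rewrite divr_gt0.
  have [d1 d10 d1P] := perturbed_short x ltr01.
  have [d2 d20 d2P] := qc_continuous qS x e30.
  pose k := `|v| * `|B x| + 1; have k0 : 0 < k by rewrite ltr_wpDl// mulr_ge0.
  pose d3 := e / 3 / k; have d30 : 0 < d3 by rewrite divr_gt0.
  exists (Num.min (Num.min d1 d2) (Num.min d3 (e / 3))).
    by rewrite !lt_min d10 d20 d30.
  move=> t /andP[t0]; rewrite !le_min => /andP[/andP[t1 t2] /andP[t3 t4]].
  have h1 := d1P t t0 t1; have h2 : `|S t x - x| <= e / 3 by rewrite d2P ?t0.
  have h3 : `|(v * t) *: B x| <= e / 3.
    rewrite normrZ normrM (ger0_norm t0) mulrAC.
    apply: (@le_trans _ _ (k * t)); first by rewrite ler_wpM2r// lerDl.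
    by rewrite mulrC -ler_pdivlMr.
  have -> : perturbed t x - x =
     (perturbed t x - S t x - (v * t) *: B x) + (v * t) *: B x + (S t x - x).
    by rewrite subrK subrKA.
  have := ler_normD (perturbed t x - S t x - (v * t) *: B x + (v * t) *: B x) (S t x - x).
  have := ler_normD (perturbed t x - S t x - (v * t) *: B x) ((v * t) *: B x).
  lra.
Qed.

(** For every [x] in the space, the difference quotients of the two semigroups differ by a quantity
    tending to [v *: B x]; so they converge for the same [x], and the domains coincide. *)
Lemma perturbed_generator x z :
  t^-1 *: (S t x - x) @[t --> 0^'+] --> z <->
  t^-1 *: (perturbed t x - x) @[t --> 0^'+] --> z + v *: B x.
Proof.
have H : t^-1 *: (perturbed t x - S t x) @[t --> 0^'+] --> v *: B x.
  apply/cvg_right0P => e e0; have [d d0 dP] := perturbed_short x e0.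
  exists d => // t t0 td.
  have -> : v *: B x - t^-1 *: (perturbed t x - S t x) =
     - (t^-1 *: (perturbed t x - S t x - (v * t) *: B x)).
    rewrite [in RHS]scalerBr scalerA [v * t]mulrC mulKf ?gt_eqF//.
    by rewrite opprB.
  rewrite normrN normrZ gtr0_norm ?invr_gt0// mulrC ler_pdivrMr//.
  exact: dP (ltW t0) td.
have E t : t^-1 *: (perturbed t x - x) =
    t^-1 *: (S t x - x) + t^-1 *: (perturbed t x - S t x).
  by rewrite -scalerDr [in RHS]addrC subrKA.
split=> h.
  rewrite (_ : (fun t => _) = (fun t => t^-1 *: (S t x - x)) \+
    (fun t => t^-1 *: (perturbed t x - S t x))); first exact: cvgD.
  by apply/funext => t; exact: E.
rewrite -(addrK (v *: B x) z) (_ : (fun t => _) =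
  (fun t => t^-1 *: (perturbed t x - x)) \-
  (fun t => t^-1 *: (perturbed t x - S t x))); first exact: cvgB.
by apply/funext => t /=; rewrite E addrK.
Qed.

End LinearControl.

Section PerturbedGenerator.
Context (R : realType) (K : numFieldType) (iota : R -> K).
Context (hK : real_or_complex iota) (X : completeNormedModType K) (N : X -> R).
Context (eN : equivalent_norm iota N).
Local Notation Y := (renormed hK eN).
Context (D : set X) (A : X -> X) (S : R -> X -> X) (gS : generates iota D A S).
Context (w : R) (qS : quasi_contractive (S : R -> Y -> Y) w).
Context (B : X -> X) (hB : bounded_operator iota B).
Context (b : R) (lB : lin_bounded (B : Y -> Y) b).

Local Notation prop := (@propagate R Y S B).

(** Additivity comes from linearity over R. A scalar of [K] acts as a bounded real-linear operator
    commuting with [S] and [B], hence with the propagator. *)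
Lemma propagate_scalar_linear U V a c : a <= c -> dominated_on U a c V ->
  uniform_on V a c -> linear (prop U a c : X -> X).
Proof.
move=> ac dV uV k x y.
have scaleP (z : X) : prop U a c (k *: z) = k *: (prop U a c z : X).
  have bk : bounded_operator iota (fun z : X => k *: z).
    split; first by move=> l z1 z2; rewrite scalerDr !scalerA mulrC.
    have [r rk] := iota_nneg_surj hK (normr_ge0 k).
    by exists r => z'; rewrite normrZ rk.
  have [q q0 qP] := renormed_bounded hK eN bk.
  apply: (@propagate_comm R Y S w qS B b lB U V a c z (fun z : X => k *: z) q
    ac dV uV _ qP) => [|t z' t0|z'].
  - exact: renormed_linear (proj1 bk).
  - case: gS => -[/(_ t t0)[lS _] _ _ _] _.
    exact: linZ lS k z'.
  - exact: linZ (proj1 hB) k z'.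
rewrite (linD (propagate_linear qS lB ac dV uV) (k *: x : X) y).
by rewrite scaleP.
Qed.

Lemma perturbed_generates (v : R) :
  generates iota D (fun x => A x + iota v *: B x) (@perturbed R Y S B v).
Proof.
have qT := perturbed_quasi_contractive qS lB v.
split.
  split.
  - move=> t t0.
    apply: (bounded_operator_renormed hK eN (c := expR ((w + b * `|v|) * t))).
    + apply: (propagate_scalar_linear t0 (@linear_dominated _ v _ _)).
      exact: linear_uniform.
    + exact: expR_ge0.
    + by move=> x; exact: (qc_bound qT).
  - exact: (qc_id qT).
  - exact: (qc_add qT).
  - move=> x; apply/(renormed_cvg hK eN)/cvg_right0P => e e0.
    have [d d0 dP] := qc_continuous qT x e0.
    by exists d => // t t0 td; rewrite distrC dP// (ltW t0).
move=> x y; have [_ genS] := gS.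
rewrite -(subrK (iota v *: B x) y).
have h := perturbed_generator qS lB v x (y - iota v *: B x).
split.
  move=> [Dx /addIr Ax]; apply/(renormed_cvg hK eN)/h/(renormed_cvg hK eN).
  exact/genS.
move=> /(renormed_cvg hK eN)/h/(renormed_cvg hK eN)/genS[Dx Ax].
by split => //; rewrite Ax.
Qed.

(** [perturbed] shows that the choice made by [semigroup] is among actual semigroups, and uniqueness
    identifies it, at nonnegative times only since its other values are arbitrary. *)
Lemma semigroup_perturbed (v t : R) : 0 <= t ->
  semigroup iota D (fun x => A x + iota v *: B x) t = @perturbed R Y S B v t.
Proof.
move=> t0; have gT := perturbed_generates v.
have : generates iota D (fun x => A x + iota v *: B x)
    (semigroup iota D (fun x => A x + iota v *: B x)).
  rewrite /semigroup; apply: (@xgetPex _ _ [set S | generates iota D _ S]).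
  by exists (@perturbed R Y S B v).
move=> [c2 g2]; apply/esym.
apply: (semigroup_unique (perturbed_quasi_contractive qS lB v)
  (renormed_C0 hK eN c2)) t0 => x z.
move=> /(renormed_cvg hK eN) h; apply/(renormed_cvg hK eN).
by apply/g2; case: gT => _ g1; apply/g1.
Qed.

End PerturbedGenerator.

(** * Integrable controls *)

Section Primitive.
Context (R : realType).
Local Notation mu := (@lebesgue_measure R).
Implicit Types (u v : R -> R) (T : R).

Definition primitive u (t : R) : R := \int[mu]_(s in `[0, t]) u s.

Lemma L1S T T' u : T' <= T -> L1 T u -> L1 T' u.
Proof.
move=> TT; apply: integrableS => //.
by apply: subset_itvl; rewrite bnd_simp.
Qed.

Lemma L1_norm T u : L1 T u -> L1 T (fun s => `|u s|).
Proof. by move=> /integrable_abse. Qed.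

Lemma L1B T u v : L1 T u -> L1 T v -> L1 T (u \- v).
Proof.
rewrite /L1/= => uT vT; rewrite (_ : EFin \o _ = ((EFin \o u) \- (EFin \o v))%E)//.
exact: integrableB.
Qed.

Lemma primitiveB T u x y : L1 T u -> 0 <= x -> x <= y -> y <= T ->
  primitive u y - primitive u x = \int[mu]_(s in `]x, y]) u s.
Proof.
move=> uT x0 xy yT; apply: Rintegral_itvB; rewrite ?bnd_simp//.
exact: L1S uT.
Qed.

Lemma L1_sub T u x y : L1 T u -> 0 <= x -> y <= T ->
  mu.-integrable `]x, y] (EFin \o u).
Proof.
move=> uT x0 yT; apply: integrableS uT => //.
by apply: subset_itv; rewrite bnd_simp.
Qed.

Lemma primitive_dominated T u :
  L1 T u -> dominated_on (primitive u) 0 T (primitive (fun s => `|u s|)).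
Proof.
move=> uT x y x0 xy yT.
rewrite (primitiveB uT)// (primitiveB (L1_norm uT))//.
apply: le_normr_Rintegral => //; exact: L1_sub uT x0 yT.
Qed.

Lemma primitive_diff_dominated T u v : L1 T u -> L1 T v ->
  dominated_on (primitive u \- primitive v) 0 T
    (primitive (fun s => `|u s - v s|)).
Proof.
move=> uT vT x y x0 xy yT /=.
have -> : primitive u y - primitive v y - (primitive u x - primitive v x) =
  primitive (u \- v) y - primitive (u \- v) x.
  rewrite (primitiveB (L1B uT vT))// RintegralB//.
  - by rewrite -(primitiveB uT)// -(primitiveB vT)//; ring.
  - exact: L1_sub uT x0 yT.
  - exact: L1_sub vT x0 yT.
exact: (primitive_dominated (L1B uT vT)).
Qed.

(** Absolute continuity of the integral, applied to [u] extended by zero outside [[0, T]]. *)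
Lemma primitive_uniform T u : L1 T u ->
  uniform_on (primitive (fun s => `|u s|)) 0 T.
Proof.
move=> uT e e0.
have : mu.-integrable setT (EFin \o u \_ `[0, T]).
  by rewrite -restrict_EFin; apply/integrable_restrict => //=; rewrite setTI.
move=> /integral_normr_continuous /(_ _ e0)[d [d0 dP]].
exists (d / 2); first by rewrite divr_gt0.
move=> x y x0 xy yT yx; rewrite (primitiveB (L1_norm uT))//.
have -> : \int[mu]_(s in `]x, y]) `|u s| = \int[mu]_(s in `]x, y]) `|(u \_ `[0, T]) s|.
  apply: eq_Rintegral => s; rewrite inE /= in_itv/= => /andP[xs sy].
  rewrite patchE ifT// inE /= in_itv/= (le_trans sy yT) andbT.
  exact: le_trans x0 (ltW xs).
apply/ltW/dP => //; rewrite /= lebesgue_measure_itv/= lte_fin.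
case: ifPn => [xy'|_]; last by rewrite lte_fin.
by rewrite -EFinB lte_fin; lra.
Qed.

(** Written as an increment to match [W c - W a] in [propagate_lipschitz]. *)
Lemma primitive_dist T u v : 0 <= T -> L1 T u -> L1 T v ->
  L1_dist T u v = (primitive (fun s => `|u s - v s|) T -
                   primitive (fun s => `|u s - v s|) 0)%:E.
Proof.
move=> T0 uT vT; rewrite /primitive set_itv1 Rintegral_set1 subr0.
rewrite /L1_dist /Rintegral fineK//; apply: integrable_fin_num => //.
exact: (L1_norm (L1B uT vT)).
Qed.

End Primitive.

Section StepControls.
Context (R : realType).
Local Notation mu := (@lebesgue_measure R).
Implicit Types (u g : R -> R) (tau v : nat -> R).

Lemma L1_step (T : R) p tau v : L1 T (step_control p tau v).
Proof.
rewrite /L1/= (_ : EFin \o _ = fun t => (\sum_(j < p)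
    ((v j)%:E * (EFin \o \1_(`[tau j, tau j.+1[%classic)) t))%E); last first.
  by apply/funext => t; rewrite /= /step_control -sumEFin.
apply: integrable_sum => // j _; apply: integrableZl => //.
apply: (@integrableS _ _ _ _ setT) => //.
exact: integrable_indic_itv.
Qed.

Lemma subdivision_le (T : R) p tau i j : subdivision T p tau ->
  (i <= j)%N -> (j <= p)%N -> tau i <= tau j.
Proof.
move=> [_ _ tauS]; elim: j => [|j IH]; first by rewrite leqn0 => /eqP->.
rewrite leq_eqVlt => /orP[/eqP->//|ij] jp.
by apply: le_trans (IH _ (ltnW jp)) (ltW (tauS j jp)); rewrite -ltnS.
Qed.

Lemma step_controlE (T : R) p tau v j t : subdivision T p tau -> (j < p)%N ->
  tau j <= t < tau j.+1 -> step_control p tau v t = v j.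
Proof.
move=> sub jp /andP[jt tj]; rewrite /step_control (bigD1 (Ordinal jp))//=.
rewrite indicE mem_set/= ?in_itv/= ?jt// mulr1 big1 ?addr0// => i ij.
rewrite indicE memNset ?mulr0//= in_itv/= => /andP[it ti].
have : i != j :> nat by apply: contra ij => /eqP e; apply/eqP/val_inj.
rewrite neq_ltn => /orP[ilj|jli].
  have := subdivision_le sub ilj (ltnW jp).
  by move=> /(lt_le_trans ti)/lt_le_trans/(_ jt); rewrite ltxx.
have := subdivision_le sub jli (ltnW (ltn_ord i)).
by move=> /(lt_le_trans tj)/lt_le_trans/(_ it); rewrite ltxx.
Qed.

Lemma primitive_step (T : R) p tau v j x y : subdivision T p tau -> (j < p)%N ->
  tau j <= x -> x <= y -> y <= tau j.+1 ->
  primitive (step_control p tau v) y - primitive (step_control p tau v) x =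
    v j * (y - x).
Proof.
move=> sub jp jx xy yj.
have t0 : tau 0%N = 0 by case: sub.
have x0 : 0 <= x.
  by apply: le_trans jx; rewrite -t0; apply: (subdivision_le sub) => //; exact: ltnW.
(* The right end is removed from the interval: when [y = tau j.+1], the control no longer takes the
   value [v j] by definition there. *)
rewrite (primitiveB (L1_step y _ _ _))// -Rintegral_itv_bndo_bndc; last first.
  apply: integrableS (L1_step y p tau v) => //.
  by apply: subset_itv; rewrite bnd_simp.
rewrite (@eq_Rintegral _ _ _ _ _ (fun=> v j)); last first.
  move=> s; rewrite inE /= in_itv/= => /andP[xs sy].
  apply: (step_controlE _ sub jp).
  by rewrite (le_trans jx (ltW xs)) (lt_le_trans sy yj).
rewrite Rintegral_cst//= lebesgue_measure_itv/= lte_fin.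
case: ifPn => [//|]; rewrite -leNgt => yx.
by have -> : y = x; [apply/le_anti; rewrite yx xy|rewrite subrr].
Qed.

Lemma continuous_uniform g (T e : R) : continuous g -> 0 < e ->
  exists2 d : R, 0 < d & forall x y, 0 <= x <= T -> `|x - y| < d -> `|g x - g y| <= e.
Proof.
move=> cg e0; have e20 : 0 < e / 2 by rewrite divr_gt0.
have /compact_near_coveringP/(_ R 0^'+
  (fun d x => forall y, `|x - y| < d -> `|g x - g y| <= e)) := @segment_compact R 0 T.
case=> [x _|d /= d0 dP].
- have /cvgrPdist_le/(_ _ e20)/nbhs_ballP[r /= r0 rP] := cg x.
  have r20 : 0 < r / 2 by rewrite divr_gt0.
  near=> x' d => y /= x'y.
  have xx' : `|x - x'| < r / 2 by near: x'; apply/nbhs_ballP; exists (r / 2).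
  have dr : d < r / 2 by near: d; exact: nbhs_right_lt.
  have h1 : `|g x - g x'| <= e / 2.
    by apply: rP; rewrite -ball_normE/=; lra.
  have h2 : `|g x - g y| <= e / 2.
    apply: rP; rewrite -ball_normE/=.
    have := ler_distD x' x y.
    lra.
  rewrite /=; apply: le_trans (ler_distD (g x) _ _) _.
  by rewrite (distrC (g x')) [e]splitr; exact: lerD.
- exists (d / 2); first by rewrite divr_gt0.
  move=> x y xT xy; apply: (dP (d / 2)) => //=.
  + by rewrite sub0r normrN gtr0_norm ?divr_gt0//; lra.
  + by rewrite divr_gt0.
Unshelve. all: by end_near. Qed.

Lemma L1_continuous_approx (T : R) u (e : R) : 0 <= T -> L1 T u -> 0 < e ->
  exists g, [/\ continuous g, L1 T g &
    primitive (fun s => `|u s - g s|) T < e].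
Proof.
move=> T0 uT e0.
have [|g_ [gc gi gcv]] :=
  approximation_continuous_integrable (measurable_itv `[0, T]) _ uT.
  by rewrite /= lebesgue_measure_itv/=; case: ifP => _; rewrite ?ltry// -EFinB ltry.
have /fine_cvgP[_ /cvgr_lt/(_ e e0)[n _ /(_ n (leqnn n)) nP]] := gcv.
exists (g_ n); split => //; exact: gi.
Qed.

(** A continuous function approximates [u] within [e / 2]; sampling it at the left ends of a fine
    regular subdivision costs [eta] at each time, that is [e / 4] in total. *)
Lemma step_dense (T : R) u (e : R) : 0 <= T -> L1 T u -> 0 < e ->
  exists p tau v, subdivision T p tau /\ (L1_dist T u (step_control p tau v) < e%:E)%E.
Proof.
rewrite le_eqVlt => /orP[/eqP<-|T0] uT e0.
  exists 0%N, (fun=> 0), (fun=> 0); split; first by split.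
  by rewrite /L1_dist set_itv1 integral_set1 lte_fin.
have TW := ltW T0; have e20 : 0 < e / 2 by rewrite divr_gt0.
have [g [cg gT ug]] := L1_continuous_approx TW uT e20.
pose eta := e / 4 / T; have eta0 : 0 < eta by rewrite !divr_gt0.
have [d d0 dP] := continuous_uniform T cg eta0.
pose p := (Num.truncn (T / d)).+1.
have p0 : 0 < p%:R :> R by rewrite ltr0n.
have pd : T / p%:R < d.
  rewrite ltr_pdivrMr// mulrC -ltr_pdivrMr//.
  have /andP[_] // : (Num.truncn (T / d))%:R <= T / d < p%:R.
  by apply: truncn_itv; rewrite divr_ge0// ltW.
pose tau (k : nat) := k%:R * (T / p%:R); pose v k := g (tau k).
have sub : subdivision T p tau.
  split; rewrite /tau; first by rewrite mul0r.
    by rewrite mulrCA divff ?mulr1// gt_eqF.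
  by move=> j _; rewrite ltr_pM2r ?divr_gt0// ltr_nat.
exists p, tau, v; split => //.
set s := step_control p tau v; have sT : L1 T s by exact: L1_step.
rewrite primitive_dist// lte_fin {2}/primitive set_itv1 Rintegral_set1 subr0.
have gs t : 0 <= t < T -> `|g t - s t| <= eta.
  move=> /andP[t0 tT]; pose j := Num.truncn (t / (T / p%:R)).
  have q0 : 0 < T / p%:R by rewrite divr_gt0.
  have /andP[j1 j2] : j%:R <= t / (T / p%:R) < j.+1%:R.
    by apply: truncn_itv; rewrite divr_ge0// ltW.
  have jt : tau j <= t by rewrite /tau -ler_pdivlMr.
  have tj : t < tau j.+1 by rewrite /tau -ltr_pdivrMr.
  have jp : (j < p)%N.
    rewrite -(ltr_nat R); apply: le_lt_trans j1 _.
    by rewrite ltr_pdivrMr// mulrCA divff ?mulr1// gt_eqF.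
  rewrite /s (step_controlE v sub jp) ?jt// /v; apply: dP; first by rewrite t0 ltW.
  rewrite ger0_norm ?subr_ge0//; apply: le_lt_trans pd.
  by move: tj; rewrite /tau -natr1 mulrDl mul1r => tj; lra.
have I1 := L1_norm (L1B uT gT); have I2 := L1_norm (L1B gT sT).
have I3 := L1_norm (L1B uT sT).
have h1 : primitive (fun t => `|u t - s t|) T <=
    primitive (fun t => `|u t - g t|) T + primitive (fun t => `|g t - s t|) T.
  rewrite /primitive -RintegralD//; apply: le_Rintegral => //.
    pose f1 t := `|(u \- g) t|; pose f2 t := `|(g \- s) t|.
    rewrite (_ : EFin \o _ = ((EFin \o f1) \+ (EFin \o f2))%E)//.
    exact: integrableD.
  by move=> t _; exact: ler_distD.
have h2 : primitive (fun t => `|g t - s t|) T <= e / 4.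
  rewrite /primitive -Rintegral_itv_bndo_bndc; last first.
    apply: integrableS I2 => //.
    by apply: subset_itvl; rewrite bnd_simp.
  apply: (@le_trans _ _ (\int[mu]_(t in `[0, T[) eta)).
    apply: le_Rintegral => //.
    - apply: integrableS I2 => //.
      by apply: subset_itvl; rewrite bnd_simp.
    - apply: measurable_bounded_integrable => //.
        by rewrite /= lebesgue_measure_itv/= lte_fin T0 -EFinB ltry.
      by exists `|eta|; split => // x xe y _ /=; exact: ltW.
  rewrite Rintegral_cst//= lebesgue_measure_itv/= lte_fin T0/= subr0.
  by rewrite /eta divfK// gt_eqF.
lra.
Qed.

End StepControls.

(** * Operator norm and uniqueness of the continuous extension *)

Section OperatorNorm.
Context (R : realType) (K : numFieldType) (iota : R -> K).
Context (hK : real_or_complex iota) (X : completeNormedModType K).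

Lemma bounded_operatorB (F G : X -> X) : bounded_operator iota F ->
  bounded_operator iota G -> exists2 M : R, 0 <= M &
    forall x, `|F x - G x| <= iota M * `|x|.
Proof.
move=> [_ [M MP]] [_ [M' M'P]]; exists (`|M| + `|M'|); first by rewrite addr_ge0.
move=> x; apply: le_trans (ler_normB _ _) _; rewrite (iota_add hK) mulrDl lerD//.
  by apply: le_trans (MP x) _; rewrite ler_wpM2r// (le_iota hK) ler_norm.
by apply: le_trans (M'P x) _; rewrite ler_wpM2r// (le_iota hK) ler_norm.
Qed.

(** [M] shows that the set of admissible constants is nonempty; the infimum of an empty set would be
    0 and carry no information on [F]. *)
Lemma opnorm_bound (M eps : R) (F : X -> X) : 0 <= M ->
  (forall x, `|F x| <= iota M * `|x|) -> opnorm iota F < eps ->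
  forall x, `|F x| <= iota eps * `|x|.
Proof.
move=> M0 MP Feps x.
have [||m [_ mP] mlt] := @inf_adherent _ [set M : R | 0 <= M /\
    forall x, `|F x| <= iota M * `|x|] (eps - opnorm iota F).
- by rewrite subr_gt0.
- by split; [exists M|exists 0 => ? []].
apply: le_trans (mP x) _; rewrite ler_wpM2r// (le_iota hK).
by move: mlt; rewrite -/(opnorm _ _) subrKC => /ltW.
Qed.

(** Both extensions agree at step controls; one of these is taken close to [u] for the two moduli of
    continuity at once. *)
Lemma continuous_extension_unique (D : set X) (A B : X -> X) (T : R)
    (F G : (R -> R) -> X -> X) (u : R -> R) : 0 <= T ->
  continuous_extension iota D A B T F -> continuous_extension iota D A B T G ->
  L1 T u -> F u = G u.
Proof.
move=> T0 [bF cF sF] [bG cG sG] uT; apply/funext => x.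
have x1 : 0 < rnorm iota x + 1.
  by rewrite ltr_wpDl// -(le_iota hK) (iota_zero hK) (rnormE hK).
suff H (e : R) : 0 < e -> rnorm iota (F u x - G u x) <= e.
  apply/eqP; rewrite -subr_eq0 -normr_le0 -(rnormE hK) -(iota_zero hK) (le_iota hK).
  by apply/ler_addgt0Pr => e e0; rewrite add0r H.
move=> e0; pose r := e / 2 / (rnorm iota x + 1).
have r0 : 0 < r by rewrite !divr_gt0.
have [d d0 dP] := cF u uT r r0; have [d' d'0 d'P] := cG u uT r r0.
have m0 : 0 < Num.min d d' by rewrite lt_min d0.
have [p [tau [v [sub dist]]]] := step_dense T0 uT m0.
set s := step_control p tau v in dist.
have sT : L1 T s by exact: L1_step.
have FG : F s = G s by rewrite sF// sG.
have dd : (Num.min d d' <= d) /\ (Num.min d d' <= d').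
  by rewrite !ge_min !lexx orbT.
have h1 : opnorm iota (fun x => F u x - F s x) < r.
  by apply: dP => //; apply: lt_le_trans dist _; rewrite lee_fin; case: dd.
have h2 : opnorm iota (fun x => G u x - G s x) < r.
  by apply: d'P => //; apply: lt_le_trans dist _; rewrite lee_fin; case: dd.
have [M M0 MP] := bounded_operatorB (bF u uT) (bF s sT).
have [M' M'0 M'P] := bounded_operatorB (bG u uT) (bG s sT).
have := opnorm_bound M0 MP h1 x; have := opnorm_bound M'0 M'P h2 x.
rewrite -!(rnormE hK) -!(iota_mul hK) !(le_iota hK) => k2 k1.
have hr : r * rnorm iota x <= e / 2.
  rewrite /r mulrAC ler_pdivrMr// ler_wpM2l ?divr_ge0 ?(ltW e0)// lerDl//.
have -> : F u x - G u x = (F u x - F s x) - (G u x - G s x).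
  by rewrite FG opprB addrA subrK.
have := en_add (rnorm_equivalent hK X) (F u x - F s x) (- (G u x - G s x)).
have -> : rnorm iota (- (G u x - G s x)) = rnorm iota (G u x - G s x).
  by apply/le_anti; rewrite -!(le_iota hK) !(rnormE hK) normrN lexx.
lra.
Qed.

End OperatorNorm.

(** * The extension and the attainable set *)

Section Extension.
Context (R : realType) (K : numFieldType) (iota : R -> K).
Context (hK : real_or_complex iota) (X : completeNormedModType K) (N : X -> R).
Context (eN : equivalent_norm iota N).
Local Notation Y := (renormed hK eN).
Context (D : set X) (A : X -> X) (S : R -> X -> X) (gS : generates iota D A S).
Context (w : R) (qS : quasi_contractive (S : R -> Y -> Y) w).
Context (B : X -> X) (hB : bounded_operator iota B).
Context (b : R) (lB : lin_bounded (B : Y -> Y) b).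

Definition extension (t : R) (u : R -> R) : X -> X :=
  @propagate R Y S B (primitive u) 0 t.

(** On [[tau j, tau j.+1]] the primitive is affine with slope [v j]. The cocycle identity splits
    this interval off, translation brings it to time 0, and there the propagator is the semigroup of
    [A + v_j B]. *)
Lemma extension_step T p tau v : subdivision T p tau ->
  extension T (step_control p tau v) = step_propagator iota D A B p tau v.
Proof.
move=> sub; have [t0 <- tauS] := sub.
set U := primitive (step_control p tau v).
have tau_ge0 j : (j <= p)%N -> 0 <= tau j.
  by move=> jp; rewrite -t0; exact: (subdivision_le sub).
suff H j : (j <= p)%N -> @propagate R Y S B U 0 (tau j) =
    step_propagator iota D A B j tau v by exact: H.
elim: j => [_|j IH jp]; first by rewrite t0; exact: (propagate_id qS lB).
have tj := tauS j jp; have tjW := ltW tj.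
have uT : L1 (tau p) (step_control p tau v) by exact: L1_step.
have dV := primitive_dominated (L1S (subdivision_le sub jp (leqnn p)) uT).
have uV := primitive_uniform (L1S (subdivision_le sub jp (leqnn p)) uT).
have jp' := ltnW jp.
apply/funext => x /=; rewrite -IH//.
rewrite (propagate_cocycle qS lB x (tau_ge0 j jp') tjW dV uV) -/U.
set y := @propagate R Y S B U 0 (tau j) x.
have d0 : 0 <= tau j.+1 - tau j by rewrite subr_ge0.
rewrite (semigroup_perturbed gS qS hB lB _ d0) /perturbed.
have := propagate_shift qS lB y (U' := U) (r := tau j) d0
  (@linear_dominated _ (v j) _ _) (@linear_uniform _ (v j) _ _).
rewrite add0r subrK; apply => t u tge tu ut.
rewrite (primitive_step v sub jp); first by ring.
- by rewrite lerDr.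
- by rewrite lerD2r.
- by move: ut; rewrite lerBrDr.
Qed.

Lemma extension_continuous T : 0 <= T ->
  continuous_extension iota D A B T (extension T).
Proof.
move=> T0; split.
- move=> u uT.
  have dV := primitive_dominated uT; have uV := primitive_uniform uT.
  apply: (bounded_operator_renormed hK eN (c := expR (w * (T - 0) + b *
    (primitive (fun s => `|u s|) T - primitive (fun s => `|u s|) 0)))).
  + exact: (propagate_scalar_linear gS qS hB lB T0 dV uV).
  + exact: expR_ge0.
  + by move=> x; exact: (propagate_bound qS lB x T0 dV uV).
- move=> u uT eps eps0.
  have dV := primitive_dominated uT; have uV := primitive_uniform uT.
  have [M M0 MP] := renormed_const hK eN.
  pose m := primitive (fun s => `|u s|) T - primitive (fun s => `|u s|) 0.
  (* A Lipschitz constant, in the norm of [X], for comparing [u] with controls at distance less than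
     1, whose mass is at most [m + 1]. *)
  pose E := expR (w * T + b * m + b * (m + 1)) * b * M.
  have b0 := lb_ge0 lB.
  have E0 : 0 <= E by rewrite mulr_ge0 ?(ltW M0)// mulr_ge0 ?expR_ge0.
  have E1 : 0 < E + 1 by rewrite ltr_wpDl.
  exists (Num.min 1 (eps / (E + 1))); first by rewrite lt_min ltr01 divr_gt0.
  move=> v vT; rewrite (primitive_dist T0 uT vT) lte_fin lt_min.
  have dV' := primitive_dominated vT; have uV' := primitive_uniform vT.
  have dW := primitive_diff_dominated uT vT.
  set W := _ - _ => /andP[W1 Weps].
  have W0 : 0 <= W by rewrite subr_ge0 (dominated_on_le dW).
  pose m' := primitive (fun s => `|v s|) T - primitive (fun s => `|v s|) 0.
  have mm' : m' <= m + 1.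
    apply: (@le_trans _ _ (m + W)); last by rewrite lerD2l ltW.
    rewrite /m /m' /W /primitive set_itv1 !Rintegral_set1 !subr0.
    pose f1 s := `|u s|; pose f2 s := `|(u \- v) s|.
    have I1 : L1 T f1 by exact: L1_norm.
    have I2 : L1 T f2 by apply: L1_norm; exact: L1B.
    apply: (@le_trans _ _
      (\int[@lebesgue_measure R]_(s in `[0, T]) (f1 s + f2 s))); last first.
      by rewrite RintegralD.
    apply: le_Rintegral => //.
    + exact: L1_norm.
    + rewrite (_ : EFin \o _ = ((EFin \o f1) \+ (EFin \o f2))%E)//.
      exact: integrableD.
    + move=> s _; rewrite /f1 /f2 /=.
      by have := lerB_dist (v s) (u s); rewrite distrC; lra.
  apply: (@opnorm_lt R K iota hK X N eN M
    (expR (w * T + b * m + b * (m + 1)) * (b * W))) => //.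
  + by rewrite mulr_ge0 ?expR_ge0// mulr_ge0.
  + move=> x; have := propagate_lipschitz qS lB x T0 dV uV dV' uV' dW.
    rewrite subr0 -/m -/m' -/W => /le_trans; apply.
    rewrite ler_wpM2r ?normr_ge0// ler_wpM2r ?mulr_ge0// ler_expR lerD2l.
    by rewrite ler_wpM2l.
  + have -> : expR (w * T + b * m + b * (m + 1)) * (b * W) * M = E * W.
      by rewrite /E; ring.
    apply: (@le_lt_trans _ _ ((E + 1) * W)); first by rewrite ler_wpM2r// lerDl.
    by rewrite mulrC -ltr_pdivlMr.
- by move=> p tau v sub; rewrite extension_step.
Qed.

Lemma propagatorE t u : 0 <= t -> L1 t u ->
  propagator iota D A B t u = extension t u.
Proof.
move=> t0 ut; apply: (continuous_extension_unique hK t0) ut; last first.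
  exact: extension_continuous.
apply: (@xgetPex _ _ [set F | continuous_extension iota D A B t F]).
by exists (extension t); exact: extension_continuous.
Qed.

Lemma attainable_sub psi0 : attainable_set iota D A B psi0 `<=`
  \bigcup_n closure (@outcomes R Y S B n%:R n%:R [set psi0]).
Proof.
move=> x [T /= T0 [u uT [t /=]]]; rewrite in_itv/= => /andP[t0 tT] <-.
have ut := L1S tT uT; rewrite (propagatorE t0 ut).
pose m := primitive (fun s => `|u s|) t - primitive (fun s => `|u s|) 0.
(* One integer bounds both the duration and the mass. *)
exists (maxn (Num.truncn t).+1 (Num.truncn m).+1) => //.
have dV := primitive_dominated ut; have uV := primitive_uniform ut.
have m0 : 0 <= m by rewrite subr_ge0 (dominated_on_le dV).
apply: (propagate_closure qS lB t0 dV uV); rewrite ?subr0.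
  have /andP[_ /ltW h] := truncn_itv t0; apply: le_trans h _.
  by rewrite ler_nat leq_maxl.
have /andP[_ /ltW h] := truncn_itv m0; apply: le_trans h _.
by rewrite ler_nat leq_maxr.
Qed.

End Extension.

(** * Density of the complement *)

Section Riesz.
Context (R : realType) (Y : completeNormedModType R).

(* Expanding x in base 2 along a finite 1/2-net of the unit ball, the digits
   used sum up to absolutely convergent coefficients. *)
Lemma unit_ball_finite_dimensional :
  totally_bounded [set x : Y | `|x| <= 1] -> ~ infinite_dimensional Y.
Proof.
move=> tb; apply; have [|s sP] := tb (1 / 2); first by rewrite divr_gt0.
pose e (i : 'I_(size s)) := s`_i; exists (size s), e.
have net (y : Y) : `|y| <= 1 -> exists i, `|y - e i| <= 1 / 2.
  move=> /sP[z zs yz]; have zi : (index z s < size s)%N by rewrite index_mem.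
  by exists (Ordinal zi); rewrite /e /= nth_index.
(* The net is nonempty, which provides a default index for vectors outside the unit ball. *)
have [i0 _] : exists i, `|0 - e i| <= 1 / 2 by apply: net; rewrite normr0.
have /choice[f fP] : forall y, exists i, `|y| <= 1 -> `|y - e i| <= 1 / 2.
  move=> y; have [/net[i yi]|y1] := leP `|y| 1; first by exists i.
  by exists i0.
suff unit (x : Y) : `|x| <= 1 -> exists c, x = \sum_i c i *: e i.
  move=> x; have [->|x0] := eqVneq x 0.
    by exists (fun=> 0); rewrite big1// => i _; rewrite scale0r.
  have nx : `|x| != 0 by rewrite normr_eq0.
  have [|c cE] := unit (`|x|^-1 *: x); first by rewrite normrZ normfV normr_id mulVf.
  exists (fun i => `|x| * c i); rewrite -[LHS](scalerKV nx) cE scaler_sumr.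
  by apply: eq_bigr => i _; rewrite scalerA.
(* [r k] is the remainder after [k] digits, rescaled by [2 ^ k]: subtracting a net point leaves norm
   at most 1/2, and doubling returns to the unit ball. *)
move=> x1; pose r k := iter k (fun y => 2 *: (y - e (f y))) x.
have r1 k : `|r k| <= 1.
  elim: k => //= k IH; rewrite normrZ ger0_norm//.
  by have := fP _ IH; lra.
pose a i k : R := if f (r k) == i then 2^-1 ^+ k else 0.
have a0 i k : 0 <= a i k by rewrite /a; case: ifP => // _; rewrite exprn_ge0.
have cva i : cvgn (series (a i)).
  apply: (@series_le_cvg _ _ (geometric 1 2^-1)) => //.
  - by move=> k; rewrite /geometric/= mul1r exprn_ge0.
  - by move=> k; rewrite /geometric/= mul1r /a; case: ifP => // _; rewrite exprn_ge0.
  - by apply: is_cvg_geometric_series; rewrite ger0_norm//; lra.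
pose p m := \sum_i series (a i) m *: e i.
have pE m : p m = x - 2^-1 ^+ m *: r m.
  elim: m => [|m IH].
    rewrite /p expr0 scale1r subrr big1// => i _.
    by rewrite /series/= big_geq// scale0r.
  have -> : p m.+1 = p m + 2^-1 ^+ m *: e (f (r m)).
    rewrite /p (eq_bigr (fun i => series (a i) m *: e i + a i m *: e i)).
      rewrite big_split/=; congr (_ + _); rewrite (bigD1 (f (r m)))//= /a eqxx.
      rewrite big1 ?addr0// => i; rewrite eq_sym => /negbTE->.
      by rewrite scale0r.
    by move=> i _; rewrite -scalerDl seriesSr addrC.
  rewrite IH /= exprSr -scalerA scalerK ?pnatr_eq0// -addrA; congr (_ + _).
  by rewrite scalerBr opprB addrC.
exists (fun i => limn (series (a i))).
have c1 : p m @[m --> \oo] --> \sum_i limn (series (a i)) *: e i.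
  by apply: cvg_big => [|i _]; [exact: add_continuous|apply: cvgZr_tmp; exact: cva].
have c2 : p m @[m --> \oo] --> x.
  apply/cvgrPdist_le => eps eps0.
  have := @cvg_expr R 2^-1; rewrite ger0_norm// => /(_ _)/cvgrPdist_le h.
  have : \forall m \near \oo, `|0 - 2^-1 ^+ m| <= eps by apply: h => //; lra.
  apply: filterS => m; rewrite sub0r normrN pE opprB subrKC normrZ => h'.
  by rewrite -[leRHS]mulr1; apply: ler_pM.
exact: cvg_unique c2 c1.
Qed.

(** If the complement of some [closure (C n)] were not dense, this set would contain a ball, and the
    nets of [C n], translated and rescaled, would make the unit ball totally bounded. *)
Lemma dense_setC_compacts (C : nat -> set Y) : infinite_dimensional Y ->
  (forall n, totally_bounded (C n)) -> dense (~` \bigcup_n closure (C n)).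
Proof.
move=> infY tC; rewrite setC_bigcup; apply: Baire => n.
split; first by apply: closed_openC; exact: closed_closure.
move=> O [x Ox] oO; apply: contrapT => H; move: infY.
apply: unit_ball_finite_dimensional.
have OC : O `<=` closure (C n).
  by move=> y Oy; apply: contrapT => Cy; apply: H; exists y.
have /nbhs_ballP[r /= r0 rO] := open_nbhs_nbhs (conj oO Ox).
have r20 : 0 < r / 2 by rewrite divr_gt0.
move=> eps eps0.
have [s sP] := tC n _ (divr_gt0 (mulr_gt0 eps0 r20) (ltr0n _ 2)).
exists [seq (r / 2)^-1 *: (y - x) | y <- s] => y /= y1.
have /OC/(_ (ball (x + (r / 2) *: y) (eps * (r / 2) / 2))) : O (x + (r / 2) *: y).
  apply: rO; rewrite -ball_normE/= opprD addrA subrr add0r normrN normrZ gtr0_norm//.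
  apply: (@le_lt_trans _ _ (r / 2)); first by rewrite ler_piMr// ltW.
  lra.
case; first by apply: nbhsx_ballx; rewrite !divr_gt0 ?mulr_gt0.
move=> z [Cz]; rewrite -ball_normE/= => yz.
have [z' z's zz'] := sP _ Cz.
exists ((r / 2)^-1 *: (z' - x)); first by apply/mapP; exists z'.
have -> : y - (r / 2)^-1 *: (z' - x) = (r / 2)^-1 *: (x + (r / 2) *: y - z').
  rewrite -{1}[y](scalerK (lt0r_neq0 r20)) -scalerBr; congr (_ *: _).
  by rewrite opprB addrCA addrA.
rewrite normrZ gtr0_norm ?invr_gt0// mulrC ler_pdivrMr//.
apply: le_trans (ler_distD z _ _) _; rewrite [leRHS]splitr.
by apply: lerD => //; exact: ltW.
Qed.

End Riesz.

Section RenormedTopology.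
Context (R : realType) (K : numFieldType) (iota : R -> K).
Context (hK : real_or_complex iota) (X : completeNormedModType K) (N : X -> R).
Context (eN : equivalent_norm iota N).
Local Notation Y := (renormed hK eN).

Lemma nbhs_renormed (x : X) (A : set X) : nbhs x A -> nbhs (x : Y) (A : set Y).
Proof.
by have /(renormed_cvg hK eN) h : (y : Y) @[y --> (x : Y)] --> (x : Y) by []; exact: h.
Qed.

Lemma closure_renormed (A : set X) : closure (A : set Y) `<=` closure A.
Proof. by move=> x clx B /nbhs_renormed; exact: clx. Qed.

Lemma dense_renormed (A : set X) : dense (A : set Y) -> dense A.
Proof.
move=> dA O O0 oO; apply: dA => //; rewrite openE => x Ox.
by apply: nbhs_renormed; exact: open_nbhs_nbhs.
Qed.

Lemma totally_bounded_renormed (A : set X) :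
  totally_bounded (A : set Y) -> totally_bounded A.
Proof.
move=> tA e e0; have [r re] := iota_nneg_surj hK (ltW e0).
move: e0; rewrite -re (iota_gt0 hK) => /tA[s sP]; exists s => x /sP[y ys xy].
by exists y => //; rewrite (rnorm_le hK); apply: le_trans xy; exact: (en_ge eN).
Qed.

Lemma infinite_dimensional_renormed :
  infinite_dimensional X -> infinite_dimensional Y.
Proof.
move=> infX [n [e eP]]; apply: infX; exists n, e => x.
by have [c cE] := eP x; exists (fun i => iota (c i)).
Qed.

End RenormedTopology.

Theorem proposition2 (R : realType) (K : numFieldType) (iota : R -> K)
    (hK : real_or_complex iota)
    (X : completeNormedModType K) (hX : infinite_dimensional X)
    (D : set X) (A : X -> X)
    (hA : exists S : R -> X -> X, generates iota D A S)
    (B : X -> X) (hB : bounded_operator iota B) :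
  (forall T : R, 0 < T ->
     (exists F, continuous_extension iota D A B T F) /\
     (forall F G, continuous_extension iota D A B T F ->
        continuous_extension iota D A B T G ->
        forall u, L1 T u -> F u = G u)) /\
  (forall psi0 : X,
     (exists C : nat -> set X, (forall n, compact (C n)) /\
        attainable_set iota D A B psi0 `<=` \bigcup_n C n) /\
     dense (~` attainable_set iota D A B psi0)).
Proof.
have [S gS] := hA; have [cS _] := gS.
have [N [eN [w qS]]] := quasi_contractive_renorm hK cS.
have [b lB] := renormed_lin_bounded hK eN hB.
split=> [T T0|psi0].
  split.
    exists (extension hK eN S B T).
    exact: (extension_continuous gS qS hB lB (ltW T0)).
  by move=> F G cF cG u; exact: (continuous_extension_unique hK (ltW T0) cF cG).
pose Z n := @outcomes R (renormed hK eN) S B n%:R n%:R [set psi0].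
have tZ n : totally_bounded (Z n).
  exact: (totally_bounded_outcomes qS lB _ _ (totally_bounded1 _)).
have sub := @attainable_sub _ _ _ _ _ _ _ _ _ _ gS _ qS _ hB _ lB psi0.
split.
  (* Closures are taken in [X], where compactness is claimed; they contain the closures in the
     renormed space, to which [sub] refers. *)
  exists (fun n => closure (Z n : set X)); split => [n|].
    by apply: totally_bounded_compact; exact: (totally_bounded_renormed (tZ n)).
  by move=> x /sub[n _ nx]; exists n => //; exact: (closure_renormed nx).
(* Riesz's theorem is applied over R: the renormed space is infinite dimensional because a finite
   family spanning over R would span over [K]. *)
apply: (@dense_renormed R K iota hK X N eN).
move=> O O0 oO.
have [x [Ox nx]] := dense_setC_compacts (infinite_dimensional_renormed hX) tZ O0 oO.
by exists x; split => // /sub.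
Qed.
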